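(* Let $T,d\in\mathbb{N}$, let $K\subseteq\mathbb{R}^d$ be a compact subset and let $f\in\mathcal{C}(K^T)$ be a function of the form $$f(x_1,\dots,x_T)=g(x_1,\dots,x_{T-1})+\sum_{i=1}^d h_i(x_1,\dots,x_{T-1})\,x_T^i$$ with continuous functions $g,h_1,\dots,h_d:(\mathbb{R}^d)^{T-1}\to\mathbb{R}$, where $x_T^i$ denotes the $i$-th component of $x_T$. Let the activation function $\sigma:\mathbb{R}\to\mathbb{R}$ be continuous, bounded, non-polynomial, injective and satisfy $\sigma(0)=0$. Let the randomised signature $\mathrm{RS}$ have random weights drawn according to Sampling Scheme 2 (described in the context), with dimension $N=M+M_1+\dots+M_d+Td$. Then for any $\alpha\in(0,1)$ and $\varepsilon>0$ there exist $M\in\mathbb{N}$ and $M_1,\dots,M_d\in\mathbb{N}$ such that, with probability greater than $\alpha$, there exist $\tilde w\in\mathbb{R}^M$ and $\tilde w_i\in\mathbb{R}^{M_i}$, $i=1,\dots,d$, such that $$\sup_{x_1,\dots,x_T\in K}\bigl|f(x_1,\dots,x_T)-\langle w,\Delta\mathrm{RS}_T(x_1,\dots,x_T)\rangle\bigr|<\varepsilon$$ for the output vector $w=[\,\tilde w^{\top}\;\;\tilde w_1^{\top}\;\cdots\;\tilde w_d^{\top}\;\;0_{1\times Td}\,]^{\top}\in\mathbb{R}^N$, where $\langle\cdot,\cdot\rangle$ denotes the standard scalar product on $\mathbb{R}^N$.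
   Context: **Randomised signature.** Let $x:\{1,\dots,T\}\to\mathbb{R}^d$ be a datastream, $x_t=(x_t^1,\dots,x_t^d)$. Given $N\in\mathbb{N}$, random matrices $A_1,A_2^1,\dots,A_2^d\in\mathbb{R}^{N\times N}$ and random vectors $\xi_1,\xi_2^1,\dots,\xi_2^d\in\mathbb{R}^N$ on a probability space $(\Omega,\mathcal{F},\mathbb{P})$, and $\sigma:\mathbb{R}\to\mathbb{R}$ (applied componentwise to vectors), the randomised signature of $x$ is defined by $\mathrm{RS}_0(x)=0\in\mathbb{R}^N$ and $$\mathrm{RS}_t(x)=\mathrm{RS}_{t-1}(x)+\sigma(A_1\mathrm{RS}_{t-1}(x)+\xi_1)+\sum_{i=1}^d\sigma(A_2^i\mathrm{RS}_{t-1}(x)+\xi_2^i)\,x_t^i,\quad t=1,\dots,T.$$ Write $\Delta\mathrm{RS}_T(x)=\Delta\mathrm{RS}_T(x_1,\dots,x_T):=\mathrm{RS}_T(x)-\mathrm{RS}_{T-1}(x)$. **Sampling Scheme 2.** Let $N=M+M_1+\dots+M_d+Td$ with $M,M_1,\dots,M_d\in\mathbb{N}$. Decompose $\mathbb{R}^N=\mathbb{R}^M\times\mathbb{R}^{M_1}\times\dots\times\mathbb{R}^{M_d}\times\mathbb{R}^{Td}$ into blocks numbered $1,2,\dots,d+1,d+2$. The weights are given blockwise as follows (all blocks not mentioned are zero), for $i=1,\dots,d$: - $A_1$ has block $(1,d+2)$ equal to $A_1^{(1)}\in\mathbb{R}^{M\times Td}$ and block $(d+2,d+2)$ equal to $A_1^{(2)}\in\mathbb{R}^{Td\times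 Td}$; - $\xi_1$ has block $1$ equal to $\tilde\xi_1\in\mathbb{R}^M$; - $A_2^i$ has block $(i+1,d+2)$ equal to $\tilde A_2^i\in\mathbb{R}^{M_i\times Td}$; - $\xi_2^i$ has block $i+1$ equal to $\tilde\xi_2^i\in\mathbb{R}^{M_i}$ and block $d+2$ equal to $\alpha_ie_i$, where $e_i$ is the $i$-th canonical basis vector of $\mathbb{R}^{Td}$ and $\alpha_i$ is a real random variable. Here $$A_1^{(2)}=\begin{bmatrix} 0_{d\times(T-1)d} & 0_{d\times d} \\ U & 0_{(T-1)d\times d} \end{bmatrix}$$ with $U\in\mathbb{R}^{(T-1)d\times(T-1)d}$ an upper triangular random matrix (entries on and above the diagonal random, entries below the diagonal zero). All random entries of $A_1^{(1)}$, $U$, $\tilde\xi_1$, $\tilde A_2^i$, $\tilde\xi_2^i$ ($i=1,\dots,d$) and the variables $\alpha_1,\dots,\alpha_d$ are i.i.d. with common law $\mu_2$, an absolutely continuous probability distribution on $\mathbb{R}$ with full support. *)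

(* Defs.v *)
From HB Require Import structures.
From mathcomp Require Import all_boot all_order all_algebra.
From mathcomp Require Import all_classical all_reals all_analysis.

Set Implicit Arguments.
Unset Strict Implicit.
Unset Printing Implicit Defensive.

Import Order.TTheory GRing.Theory Num.Theory.
Import numFieldNormedType.Exports.

Local Open Scope classical_set_scope.
Local Open Scope ring_scope.

(* MathComp-Analysis, over an arbitrary [R : realType].  Vectors of R^N are
   columns, a datastream of length T in R^d is a T x d matrix whose rows are
   the observations, and matrices carry the product topology.  [T] is always of
   the form [T'.+1], so that [T'] stands for T - 1. *)

Section RandomisedSignature.
Context (R : realType) (N d T' : nat).
Variables (sigma : R -> R) (A1 : 'M[R]_N) (xi1 : 'cV[R]_N)
  (A2 : 'I_d -> 'M[R]_N) (xi2 : 'I_d -> 'cV[R]_N).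

(* The observations x_1, ..., x_T are the rows 0, ..., T' of [x]; the value
   [RS x t] is meaningful for t <= T'.+1 only. *)
Fixpoint RS (x : 'M[R]_(T'.+1, d)) (t : nat) : 'cV[R]_N :=
  if t is s.+1 then
    RS x s + map_mx sigma (A1 *m RS x s + xi1)
    + \sum_(i < d) x (inord s) i *: map_mx sigma (A2 i *m RS x s + xi2 i)
  else 0.

Definition DeltaRS (x : 'M[R]_(T'.+1, d)) : 'cV[R]_N :=
  RS x T'.+1 - RS x T'.

End RandomisedSignature.

Section SamplingScheme2.
Context (R : realType) (d T' M : nat) (Mi : 'I_d -> nat).

(* One index per random scalar.  [WU] ranges over the entries of U on and above
   the diagonal only. *)
Inductive windex : Type :=
| WA1 of 'I_M & 'I_(T'.+1 * d)
| WU of {p : 'I_(T' * d) * 'I_(T' * d) | (p.1 <= p.2)%N}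
| Wxi1 of 'I_M
| WA2 (i : 'I_d) of 'I_(Mi i) & 'I_(T'.+1 * d)
| Wxi2 (i : 'I_d) of 'I_(Mi i)
| Walpha of 'I_d.

Definition sigdim : nat := (M + \sum_(i < d) Mi i + T'.+1 * d)%N.

Variable v : windex -> R.

Definition upperU : 'M[R]_(T' * d) :=
  \matrix_(j, k) (if insub (j, k) is Some p then v (WU p) else 0).

Definition schemeA12 : 'M[R]_(T'.+1 * d) :=
  castmx (esym (mulSn T' d), esym (mulSnr T' d))
    (block_mx (0 : 'M[R]_(d, T' * d)) (0 : 'M[R]_(d, d))
              upperU               (0 : 'M[R]_(T' * d, d))).

Definition schemeA1 : 'M[R]_sigdim :=
  block_mx 0 (col_mx (\matrix_(j, k) v (WA1 j k)) 0)
           0 schemeA12.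

Definition schemexi1 : 'cV[R]_sigdim :=
  col_mx (col_mx (\col_j v (Wxi1 j)) 0) 0.

Definition schemeA2 (i : 'I_d) : 'M[R]_sigdim :=
  block_mx
    0 (col_mx 0 (\mxcol_j (if j == i then \matrix_(k, l) v (WA2 k l) else 0)))
    0 0.

Definition schemexi2 (i : 'I_d) : 'cV[R]_sigdim :=
  col_mx (col_mx 0 (\mxcol_j (if j == i then \col_k v (Wxi2 k) else 0)))
         (v (Walpha i) *: delta_mx (lshift (T' * d) i) 0).

Definition scheme_DeltaRS (sigma : R -> R) (x : 'M[R]_(T'.+1, d)) :
    'cV[R]_sigdim :=
  DeltaRS sigma schemeA1 schemexi1 schemeA2 schemexi2 x.

End SamplingScheme2.

Definition output_vector (R : realType) (d T' M : nat) (Mi : 'I_d -> nat)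
    (w : 'cV[R]_M) (wi : forall i : 'I_d, 'cV[R]_(Mi i)) :
    'cV[R]_(sigdim T' M Mi) :=
  col_mx (col_mx w (\mxcol_i wi i)) 0.

Definition dotprod (R : realType) (N : nat) (u v : 'cV[R]_N) : R :=
  \sum_(k < N) u k 0 * v k 0.

Definition mutually_independent (R : realType) (disp : measure_display)
    (Omega : measurableType disp) (P : probability Omega R)
    (I : Type) (X : I -> {RV P >-> R}) : Prop :=
  forall (n : nat) (s : 'I_n -> I) (B : 'I_n -> set R),
    injective s -> (forall k, measurable (B k)) ->
    P (\bigcap_(k in [set: 'I_n]) X (s k) @^-1` B k) =
      (\prod_(k < n) P (X (s k) @^-1` B k))%E.

Definition iid (R : realType) (disp : measure_display)
    (Omega : measurableType disp) (P : probability Omega R)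
    (I : Type) (X : I -> {RV P >-> R})
    (mu : probability (measurableTypeR R) R) : Prop :=
  mutually_independent X /\
  forall i B, measurable B -> distribution P (X i) B = mu B.

Definition measure_support (R : realType)
    (mu : probability (measurableTypeR R) R) : set R :=
  [set x | forall U : set R, open U -> U x -> (0 < mu U)%E].

Definition full_support (R : realType)
    (mu : probability (measurableTypeR R) R) : Prop :=
  measure_support mu = setT.

Definition stream_set (R : realType) (d T : nat) (K : set 'rV[R]_d) :
    set 'M[R]_(T, d) :=
  [set x | forall t, K (row t x)].

(* Main.v *)
Require Import Defs.
From HB Require Import structures.
From mathcomp Require Import all_boot all_order all_algebra.
From mathcomp Require Import all_classical all_reals all_analysis.
From mathcomp Require Import measurable_realfun ring lra.

Set Implicit Arguments.
Unset Strict Implicit.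
Unset Printing Implicit Defensive.

Import Order.TTheory GRing.Theory Num.Theory.
Import numFieldNormedType.Exports.

Local Open Scope classical_set_scope.
Local Open Scope ring_scope.

(* Since sigma is continuous, injective and bounded, it is strictly monotone with
   distinct limits at -oo and +oo, so sums of its dilates approximate every
   continuous function on a segment, in particular exp.  For weights U with
   nonzero diagonal and alpha_i <> 0, the last block of RS_{T-1} is an injective
   continuous function of (x_1, ..., x_{T-1}); by Stone-Weierstrass applied to
   the exponentials of its linear forms, g and the h_i are uniformly
   approximated by networks fed with that block.  A network stays good when its
   weights and (U, alpha) move a little, so over a compact set of (U, alpha) of
   large probability finitely many boxes of neuron weights suffice: as soon as
   every box contains a sampled neuron, output weights exist.  Each box has
   positive probability by full support, hence all are hit with probability
   tending to 1 with the number of neurons. *)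

(** * Stone-Weierstrass *)

(** The neuron counts must be fixed before anything is drawn, yet all neurons read the same random
    features, those built from (U, alpha). The approximation must therefore be uniform in (U,
    alpha), while the output weights may still depend on them. Absolute continuity supplies the
    compact set: 0 carries no mass, so the diagonal of U and the alpha_i can be kept away from it.
    Exponentials are the detour because products of exponentials of linear forms are again of that
    kind, so their span is an algebra, which the span of neurons need not be; each exponential is
    then a function of one real variable, where a staircase of dilates of sigma works. The last
    observation enters the increment only through the factors x_T^i, which is the shape assumed of
    f: block 1 serves g and block i+1 serves h_i. The existence of real output weights is an
    uncountable union of events, so measurability needs its own argument, by openness in the sampled
    weights. *)

Lemma compact_ind (X : topologicalType) (K : set X) (Pr : set X -> Prop) :
  compact K -> Pr set0 -> (forall B C, B `<=` C -> Pr C -> Pr B) ->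
  (forall B C, Pr B -> Pr C -> Pr (B `|` C)) ->
  (forall x, K x -> exists2 U, nbhs x U & Pr U) -> Pr K.
Proof.
move=> Kc Pr0 PrS PrU Prloc; apply: contrapT => nPrK.
(* Failure of [Pr K] makes [F] a proper filter containing [K]. At a cluster point, a neighbourhood
   [U] with [Pr U] has its complement in [F], which is absurd. *)
pose F := [set B | Pr (K `\` B)].
have FF : ProperFilter F.
  apply: Build_ProperFilter; first by rewrite /F/= setD0.
  split; rewrite /F/=; first by rewrite setDT.
  - by move=> B C; rewrite /= setDIr; exact: PrU.
  - by move=> B C BC; apply: PrS => x [Kx nCx]; split => // /BC.
have [|x [Kx clx]] := Kc F FF; first by rewrite /F/= setDv.
have [U Ux PU] := Prloc _ Kx.
have FU : F (~` U) by apply: PrS PU => y [_ /contrapT].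
by have [y []] := clx _ _ FU Ux.
Qed.

Section AbsoluteValue.
Context {R : realType}.

(* Visser's iteration for the square root of [x ^+ 2], a polynomial in [x] at
   every step. *)
Fixpoint abs_iter (x : R) (n : nat) : R :=
  if n is m.+1 then abs_iter x m + 2^-1 * (x ^+ 2 - abs_iter x m ^+ 2) else 0.

(** With t = |x|, one step gives t - q' = (t - q)(1 - (t + q)/2), with factor at most 1 - t/2. The
    third clause is the resulting bound t - q_n <= 2t/(2 + nt), cleared of its denominator; it is at
    most 2/n for n > 0, uniformly in x, although the contraction degenerates at t = 0. *)
Lemma abs_iter_bounds (x : R) n : `|x| <= 1 ->
  [/\ 0 <= abs_iter x n, abs_iter x n <= `|x| &
      (`|x| - abs_iter x n) * (2 + n%:R * `|x|) <= 2 * `|x|].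
Proof.
move=> x1; have x0 : 0 <= `|x| by [].
elim: n => [|n [q0 qx qe]] /=.
  by split => //; rewrite mul0r addr0 subr0 mulrC.
have -> : x ^+ 2 = `|x| ^+ 2 by rewrite real_normK ?num_real.
move: (abs_iter x n) q0 qx qe => q q0 qx qe.
move: `|x| x0 x1 qx qe => t t0 t1 qt qe.
have n0 : 0 <= (n%:R : R) by [].
split; first nra.
  have -> : q + 2^-1 * (t ^+ 2 - q ^+ 2) =
     t - (t - q) * (1 - 2^-1 * (t + q)) by field.
  rewrite gerBl mulr_ge0 ?subr_ge0//; lra.
apply: le_trans qe.
have -> : t - (q + 2^-1 * (t ^+ 2 - q ^+ 2)) =
   (t - q) * (1 - 2^-1 * (t + q)) by field.
rewrite -mulrA ler_wpM2l ?subr_ge0// -(@natr1 _ n).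
apply: (@le_trans _ _ ((1 - 2^-1 * t) * (2 + (n%:R + 1) * t))).
  apply: ler_wpM2r; last lra.
  by rewrite addr_ge0// mulr_ge0// addr_ge0.
have : 0 <= n%:R * t ^+ 2 by rewrite mulr_ge0// sqr_ge0.
have : 0 <= t ^+ 2 by rewrite sqr_ge0.
nra.
Qed.

Lemma abs_iter_cvg (e : R) : 0 < e ->
  exists n, forall x : R, `|x| <= 1 -> `|abs_iter x n - `|x| | <= e.
Proof.
move=> e0; exists (Num.truncn (2 / e)).+1 => x x1.
set n := _.+1; have [q0 qx qe] := abs_iter_bounds n x1.
rewrite distrC ger0_norm ?subr_ge0// leNgt; apply/negP => lte.
have en : 2 < e * n%:R.
  by rewrite mulrC -ltr_pdivrMr//; apply: truncnS_gt.
move: qe; rewrite leNgt => /negP; apply.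
have x0 : 0 < `|x| by lra.
apply: (@lt_trans _ _ (e * (2 + n%:R * `|x|))).
  have : 2 * `|x| < e * n%:R * `|x| by rewrite ltr_pM2r.
  nra.
by rewrite ltr_pM2r// addr_gt0// mulr_gt0.
Qed.

End AbsoluteValue.

Definition unif_closure {R : realType} {X : Type} (Y : set X)
    (B : set (X -> R)) : set (X -> R) :=
  [set F | forall e : R, 0 < e ->
    exists2 p, B p & forall y, Y y -> `|F y - p y| <= e].

Section StoneWeierstrass.
Context {R : realType} {X : topologicalType} (Y : set X) (A : set (X -> R)).
Hypotheses (Yc : compact Y) (Acont : forall p, A p -> continuous p)
  (Acst : forall c, A (fun=> c))
  (Aadd : forall p q, A p -> A q -> A (fun x => p x + q x))
  (Amul : forall p q, A p -> A q -> A (fun x => p x * q x))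
  (Asep : forall x y, Y x -> Y y -> x <> y -> exists2 p, A p & p x <> p y).

(** Maxima and minima leave [A] but stay in its uniform closure. Continuity is recorded as well
    because the compactness arguments need strict inequalities between such functions and F to be
    open. *)
Let L : set (X -> R) := [set F | continuous F /\ unif_closure Y A F].

Let LA p : A p -> L p.
Proof.
move=> Ap; split; first exact: Acont.
by move=> e e0; exists p => // y _; rewrite subrr normr0 ltW.
Qed.

Let Ladd p q : L p -> L q -> L (fun x => p x + q x).
Proof.
move=> [pc pA] [qc qA]; split; first by move=> x; apply: cvgD; [exact: pc|exact: qc].
move=> e e0; have e20 : 0 < e / 2 by rewrite divr_gt0.
have [p' Ap' pp'] := pA _ e20; have [q' Aq' qq'] := qA _ e20.
exists (fun x => p' x + q' x); first exact: Aadd.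
move=> y Yy; rewrite opprD addrACA (splitr e).
by rewrite (le_trans (ler_normD _ _))// lerD ?pp' ?qq'.
Qed.

Let Lscale c p : L p -> L (fun x => c * p x).
Proof.
move=> [pc pA]; split; first by move=> x; apply: cvgM; [exact: cvg_cst|exact: pc].
move=> e e0; have c0 : 0 < `|c| + 1 by rewrite ltr_wpDl.
have [|p' Ap' pp'] := pA (e / (`|c| + 1)); first by rewrite divr_gt0.
exists (fun x => c * p' x); first exact: Amul.
move=> y Yy; rewrite -mulrBr normrM.
apply: (@le_trans _ _ ((`|c| + 1) * (e / (`|c| + 1)))).
  by rewrite ler_pM ?pp'// lerDl.
by rewrite mulrC divfK ?gt_eqF.
Qed.

Let A_abs_iter p n : A p -> A (fun x => abs_iter (p x) n).
Proof.
move=> Ap; elim: n => [|n IH] /=; first exact: Acst.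
apply: Aadd => //; apply: Amul; first exact: Acst.
apply: Aadd.
  by apply: (Amul Ap Ap).
rewrite (_ : (fun x => _) = fun x => -1 * (abs_iter (p x) n * abs_iter (p x) n)).
  by apply: Amul; [exact: Acst|exact: Amul].
by apply/funext => x; rewrite mulN1r.
Qed.

(** Dividing an approximant by a bound C of it on [Y] brings its values into [-1, 1], where
    [abs_iter] is close to the absolute value; composing [abs_iter] with an element of [A] stays in
    [A]. *)
Let Labs p : L p -> L (fun x => `|p x|).
Proof.
move=> [pc pA]; split.
  by move=> x; apply: (@cvg_norm _ _ _ (nbhs x)); exact: pc.
move=> e e0; have e20 : 0 < e / 2 by rewrite divr_gt0.
have [p' Ap' pp'] := pA _ e20.
have [C C0 p'C] : exists2 C, 0 < C & forall y, Y y -> `|p' y| <= C.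
  have : compact (p' @` Y).
    by apply: continuous_compact => //; apply: continuous_subspaceT; exact: Acont.
  move/compact_bounded => [C [_ pC]]; exists (`|C| + 1); first by rewrite ltr_wpDl.
  move=> y Yy; apply: pC; last by exists y.
  by rewrite (le_lt_trans (ler_norm _))// ltrDl.
have [|n qn] := @abs_iter_cvg R (e / 2 / C); first by rewrite divr_gt0.
exists (fun x => C * abs_iter (C^-1 * p' x) n).
  apply: Amul; first exact: Acst.
  by apply: A_abs_iter; apply: Amul => //; exact: Acst.
move=> y Yy; have := qn (C^-1 * p' y).
rewrite normrM gtr0_norm ?invr_gt0// ler_pdivrMl// mulr1 => /(_ (p'C _ Yy)) qe.
have {}qe : `|C * abs_iter (C^-1 * p' y) n - `|p' y| | <= e / 2.
  rewrite -(mulVKf (lt0r_neq0 C0) `|p' y|) -mulrBr normrM gtr0_norm//.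
  by rewrite mulrC -ler_pdivlMr.
have := pp' _ Yy => /(le_trans (ler_dist_dist _ _)) h1.
move: qe h1; rewrite !ler_norml; lra.
Qed.

Let Lmax p q : L p -> L q -> L (fun x => Num.max (p x) (q x)).
Proof.
move=> Lp Lq.
rewrite (_ : (fun x => _) =
  fun x => 2^-1 * ((p x + q x) + `|p x + (-1) * q x|)).
  apply: (Lscale _); apply: Ladd; first exact: Ladd.
  by apply: (Labs); apply: Ladd => //; exact: Lscale.
by apply/funext => x; rewrite mulN1r maxr_absE mulrC.
Qed.

Let Lmin p q : L p -> L q -> L (fun x => Num.min (p x) (q x)).
Proof.
move=> Lp Lq.
rewrite (_ : (fun x => _) =
  fun x => 2^-1 * ((p x + q x) + (-1) * `|p x + (-1) * q x|)).
  apply: (Lscale _); apply: Ladd; first exact: Ladd.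
  by apply: (Lscale _); apply: (Labs); apply: Ladd => //; exact: Lscale.
by apply/funext => x; rewrite !mulN1r minr_absE mulrC.
Qed.

Let interpolation (F : X -> R) x y : Y x -> Y y ->
  exists p, [/\ A p, p x = F x & p y = F y].
Proof.
move=> Yx Yy; have [->|xy] := pselect (x = y); first by exists (fun=> F y); split.
have [p Ap pxy] := Asep Yx Yy xy.
have px0 : p y - p x != 0 by rewrite subr_eq0 eq_sym; apply/eqP.
pose c := (F y - F x) / (p y - p x).
exists (fun z => (F x - c * p x) + c * p z); split.
- by apply: Aadd; [exact: Acst|apply: Amul => //; exact: Acst].
- by rewrite subrK.
- by rewrite -addrA [- _ + _]addrC -mulrBr /c divfK// addrC subrK.
Qed.

Let near_gt (f g : X -> R) x : continuous f -> continuous g -> f x < g x ->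
  nbhs x [set y | f y < g y].
Proof.
move=> fc gc fg.
have h : (g \- f) y @[y --> x] --> (g \- f) x by apply: cvgB; [exact: gc|exact: fc].
have := @cvgr_gt _ _ _ _ _ _ h 0; rewrite /= subr_gt0 => /(_ _ fg).
by apply: filterS => y /=; rewrite subr_gt0.
Qed.

(** [L] is a lattice that interpolates at any two points. For fixed x, a maximum of interpolants
    over a finite cover exceeds F - e on [Y] and stays below F + e at x; a minimum of such functions
    over finitely many x is then within e of F. *)
Theorem stone_weierstrass (F : X -> R) : continuous F -> unif_closure Y A F.
Proof.
move=> Fc.
suff H : forall e, 0 < e -> exists2 p, L p & forall y, Y y -> `|F y - p y| <= e.
  move=> e e0; have e20 : 0 < e / 2 by rewrite divr_gt0.
  have [p [_ pA] Fp] := H _ e20; have [q Aq pq] := pA _ e20.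
  exists q => // y Yy; have := Fp _ Yy; have := pq _ Yy.
  by rewrite !ler_norml; lra.
move=> e e0.
have contDe c : continuous (fun y => F y + c).
  by move=> y; apply: cvgD; [exact: Fc|exact: cvg_cst].
have below x : Y x -> exists p, [/\ L p, p x < F x + e &
    forall y, Y y -> F y - e < p y].
  (* [Y y] is repeated so that the claim is literally the case B = Y of the property given to the
     compactness induction. *)
  move=> Yx; suff [p [Lp px pY]] : exists p, [/\ L p, p x < F x + e &
    forall y, Y y -> Y y -> F y - e < p y].
    by exists p; split => // y Yy; exact: pY.
  apply: (@compact_ind X Y (fun B => exists p, [/\ L p, p x < F x + e &
    forall y, B y -> Y y -> F y - e < p y])) => //.
  - exists (fun=> F x); split => //; first by apply: (LA); exact: Acst.
    by rewrite ltrDl.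
  - by move=> B C BC [p [Lp px pC]]; exists p; split => // y /BC; exact: pC.
  - move=> B C [p [Lp px pB]] [q [Lq qx qC]].
    exists (fun x => Num.max (p x) (q x)); split.
    + exact: Lmax.
    + by rewrite gt_max px.
    + by move=> y [/pB h|/qC h] /h; rewrite lt_max => ->//; rewrite orbT.
  - move=> y Yy; have [p [Ap px py]] := interpolation F Yx Yy.
    exists [set z | F z - e < p z].
      by apply: near_gt; [exact: contDe|exact: Acont|rewrite py gtrBl].
    by exists p; split; [exact: LA|rewrite px ltrDl|move=> z /=].
suff [p [Lp pF pY]] : exists p, [/\ L p, forall y, Y y -> F y - e < p y &
    forall y, Y y -> Y y -> p y < F y + e].
  exists p => // y Yy; have := pF _ Yy; have := pY _ Yy Yy.
  by rewrite ler_norml; lra.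
apply: (@compact_ind X Y (fun B => exists p, [/\ L p,
    forall y, Y y -> F y - e < p y & forall y, B y -> Y y -> p y < F y + e])) => //.
- have [->|/set0P[x Yx]] := eqVneq Y set0.
    by exists (fun=> 0); split => //; apply: (LA); exact: Acst.
  by have [p [Lp _ pY]] := below _ Yx; exists p; split.
- by move=> B C BC [p [Lp px pC]]; exists p; split => // y /BC; exact: pC.
- move=> B C [p [Lp px pB]] [q [Lq qx qC]].
  exists (fun x => Num.min (p x) (q x)); split.
  + exact: Lmin.
  + by move=> y Yy; rewrite lt_min px// qx.
  + by move=> y [/pB h|/qC h] /h; rewrite gt_min => ->//; rewrite orbT.
- move=> x Yx; have [p [Lp px pY]] := below _ Yx.
  exists [set z | p z < F z + e]; last by exists p; split.
  by apply: near_gt px; [exact: Lp.1|exact: contDe].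
Qed.

End StoneWeierstrass.

(** * Approximation by a sigmoidal function *)

(** A tube argument: compactness of [Y] makes the modulus of continuity at [v] uniform in the second
    variable. All later perturbation steps (of an argument of psi, of neuron weights, of sampled
    parameters) rest on it. *)
Lemma near_compact_continuous {R : realType} (V X : topologicalType) (Y : set X)
    (D : V * X -> R) (v : V) :
  compact Y -> continuous D -> forall e : R, 0 < e ->
  \forall v' \near v, forall x, Y x -> `|D (v', x) - D (v, x)| < e.
Proof.
move=> /compact_near_coveringP Yc Dc e e0.
apply: (Yc _ (nbhs v) (fun v' x => `|D (v', x) - D (v, x)| < e)) => x Yx.
have e20 : 0 < e / 2 by rewrite divr_gt0.
have := Dc (v, x) => /cvgrPdist_lt /(_ _ e20) [[U W]] /= [Uv Wx] UW.
exists (W, U) => //= -[x' v'] /= [Wx' Uv'].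
have := UW (v', x') (conj Uv' Wx'); have := UW (v, x') (conj (nbhs_singleton Uv) Wx').
rewrite /= !ltr_norml; lra.
Qed.

Lemma unif_closure_idem {R : realType} (X : Type) (Y : set X)
    (B : set (X -> R)) :
  unif_closure Y (unif_closure Y B) `<=` unif_closure Y B.
Proof.
move=> F FB e e0; have e20 : 0 < e / 2 by rewrite divr_gt0.
have [p pB Fp] := FB _ e20; have [q Bq pq] := pB _ e20.
exists q => // y Yy; have := Fp _ Yy; have := pq _ Yy.
rewrite !ler_norml; lra.
Qed.

(** * Linear spans and their uniform closures *)

Section Span.
Context {R : realType} {X : Type}.
Implicit Types D : set (X -> R).

Inductive span D : set (X -> R) :=
| span_nil : span D (fun=> 0)
| span_cons c p F : D p -> span D F -> span D (fun x => c * p x + F x).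

Lemma span_incl D : D `<=` span D.
Proof.
move=> p Dp; rewrite (_ : p = fun x => 1 * p x + 0).
  by apply: span_cons => //; exact: span_nil.
by apply/funext => x; rewrite mul1r addr0.
Qed.

Lemma spanD D p q : span D p -> span D q -> span D (fun x => p x + q x).
Proof.
move=> Dp Dq; elim: Dp => [|c r F Dr _ IH].
  by rewrite (_ : (fun x => _) = q)//; apply/funext => x; rewrite add0r.
rewrite (_ : (fun x => _) = fun x => c * r x + (F x + q x)).
  exact: span_cons.
by apply/funext => x; rewrite addrA.
Qed.

Lemma spanZ D c p : span D p -> span D (fun x => c * p x).
Proof.
elim => [|a r F Dr _ IH].
  by rewrite (_ : (fun x => _) = fun=> 0);
    [exact: span_nil|apply/funext => x; rewrite mulr0].
rewrite (_ : (fun x => _) = fun x => (c * a) * r x + (c * F x)).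
  exact: span_cons.
by apply/funext => x; rewrite mulrDr mulrA.
Qed.

Lemma spanM D p q : (forall r s, D r -> D s -> D (fun x => r x * s x)) ->
  span D p -> span D q -> span D (fun x => p x * q x).
Proof.
move=> DM Dp Dq; elim: Dp => [|c r F Dr _ IH].
  by rewrite (_ : (fun x => _) = fun=> 0);
    [exact: span_nil|apply/funext => x; rewrite mul0r].
rewrite (_ : (fun x => _) = fun x => c * (r x * q x) + F x * q x).
  apply: spanD => //; apply: spanZ.
  elim: Dq => [|a s G Ds _ IHG].
    by rewrite (_ : (fun x => _) = fun=> 0);
      [exact: span_nil|apply/funext => x; rewrite mulr0].
  rewrite (_ : (fun x => _) = fun x => a * (r x * s x) + r x * G x).
    by apply: span_cons => //; exact: DM.
  by apply/funext => x; rewrite mulrDr mulrCA.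
by apply/funext => x; rewrite mulrDl mulrA.
Qed.

Variable Y : set X.

Lemma unif_closure_incl (B : set (X -> R)) : B `<=` unif_closure Y B.
Proof. by move=> p Bp e /ltW e0; exists p => // y _; rewrite subrr normr0. Qed.

Lemma unif_closureD D p q : unif_closure Y (span D) p ->
  unif_closure Y (span D) q -> unif_closure Y (span D) (fun x => p x + q x).
Proof.
move=> pD qD e e0; have e20 : 0 < e / 2 by rewrite divr_gt0.
have [p' Dp pp] := pD _ e20; have [q' Dq qq] := qD _ e20.
exists (fun x => p' x + q' x); first exact: spanD.
move=> y Yy; have := pp _ Yy; have := qq _ Yy; rewrite !ler_norml; lra.
Qed.

Lemma unif_closureZ D c p : unif_closure Y (span D) p ->
  unif_closure Y (span D) (fun x => c * p x).
Proof.
move=> pD e e0; have c0 : 0 < `|c| + 1 by rewrite ltr_wpDl.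
have [|p' Dp pp] := pD (e / (`|c| + 1)); first by rewrite divr_gt0.
exists (fun x => c * p' x); first exact: spanZ.
move=> y Yy; rewrite -mulrBr normrM.
apply: (@le_trans _ _ ((`|c| + 1) * (e / (`|c| + 1)))).
  by rewrite ler_pM ?pp// lerDl.
by rewrite mulrC divfK ?gt_eqF.
Qed.

Lemma unif_closure_span D D' : D `<=` unif_closure Y (span D') ->
  unif_closure Y (span D) `<=` unif_closure Y (span D').
Proof.
move=> DD'; have sDD' p : span D p -> unif_closure Y (span D') p.
  elim => [|c r F Dr _ IH]; first exact/unif_closure_incl/span_nil.
  by apply: unif_closureD => //; apply: unif_closureZ; exact: DD'.
move=> F FD; apply: unif_closure_idem => e /FD[p Dp Fp].
by exists p => //; exact: sDD'.
Qed.

End Span.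

Section Sigmoidal.
Context {R : realType} (sigma : R -> R).

(** The limits are l at -oo and L at +oo, with one threshold for both ends. L < l is allowed, so
    decreasing functions qualify. *)
Definition sigmoidal := exists l L, [/\ l != L, exists C, forall v : R, `|sigma v| <= C &
  forall e : R, 0 < e -> exists B, forall v : R, B <= v ->
    `|sigma v - L| <= e /\ `|sigma (- v) - l| <= e].

End Sigmoidal.

Section SigmoidalApproximation.
Context {R : realType}.

Lemma increasing_sigmoidal (s : R -> R) : {homo s : x y / x < y} ->
  (exists C, forall v : R, `|s v| <= C) -> sigmoidal s.
Proof.
move=> s_incr [C sC].
have sle : {homo s : x y / x <= y}.
  by move=> x y; rewrite le_eqVlt => /orP[/eqP->//|/s_incr/ltW].
have hs : has_sup (range s).
  by split; [exists (s 0), 0|exists C => _ [x _ <-]; exact: le_trans (ler_norm _) _].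
have hi : has_inf (range s).
  split; [by exists (s 0), 0|exists (- C) => _ [x _ <-]].
  by have := sC x; rewrite ler_norml => /andP[].
exists (inf (range s)), (sup (range s)).
have ub v : s v <= sup (range s) by apply: sup_ubound; [exact: hs.2|exists v].
have lb v : inf (range s) <= s v by apply: inf_lbound; [exact: hi.2|exists v].
split; [|by exists C|].
  rewrite lt_eqF// (le_lt_trans (lb 0))// (lt_le_trans _ (ub 1))//.
  by apply: s_incr.
move=> e e0.
have [_ [x _ <-] sx] := sup_adherent e0 hs.
have [_ [y _ <-] sy] := inf_adherent e0 hi.
exists (Num.max x (- y)) => v; rewrite ge_max => /andP[xv yv].
have sxv := sle _ _ xv; have syv : s (- v) <= s y by apply: sle; lra.
by have := ub v; have := lb (- v); rewrite !ler_norml; lra.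
Qed.

Lemma continuous_injective_sigmoidal (s : R -> R) : continuous s ->
  injective s -> (exists C, forall v : R, `|s v| <= C) -> sigmoidal s.
Proof.
move=> sc si sb.
have [||h|h] := @itv_continuous_inj_mono R s `]-oo, +oo[.
- by apply: continuous_subspaceT.
- by move=> x y _ _; exact: si.
- by apply: increasing_sigmoidal => // x y xy; rewrite h.
- have [||l [L [lL _ lim]]] := @increasing_sigmoidal (fun x => - s x).
  + by move=> x y xy; rewrite ltrN2 h.
  + by have [C sC] := sb; exists C => v; rewrite normrN.
  exists (- l), (- L); split => //; first by rewrite eqr_opp.
  move=> e /lim[B Be]; exists B => v /Be.
  by rewrite -(normrN (- s v - L)) -(normrN (- s (- v) - l)) !opprB !opprK
     [L + _]addrC [l + _]addrC.
Qed.

Variables (X : Type) (Y : set X) (sigma : R -> R).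
Hypothesis sig : sigmoidal sigma.

(** An affine change of values moves the two limits to 0 and 1. The bound [C] precedes [e] because
    the mesh of the staircase is chosen from [C] before the accuracy of the steps is known. *)
Let sigma_unit_step : exists C, 1 <= C /\ forall e : R, 0 < e -> exists c a b, [/\
  forall v : R, `|b + c * sigma v| <= C,
  forall v : R, a <= v -> `|b + c * sigma v - 1| <= e &
  forall v : R, v <= - a -> `|b + c * sigma v| <= e].
Proof.
have [l [L [lL [C sC] lim]]] := sig.
have lL0 : L - l != 0 by rewrite subr_eq0 eq_sym.
pose c := (L - l)^-1; have c0 : 0 < `|c| by rewrite normr_gt0 invr_eq0.
have bE v : - (c * l) + c * sigma v = c * (sigma v - l).
  by rewrite mulrBr addrC.
exists (1 + `|c| * (C + `|l|)); split.
  rewrite lerDl mulr_ge0// addr_ge0//.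
  exact: le_trans (sC 0).
move=> e e0; have [|B Be] := lim (e / `|c|); first by rewrite divr_gt0.
exists c, B, (- (c * l)); split => v.
- rewrite bE normrM (@le_trans _ _ (`|c| * (C + `|l|)))// ?lerDr//.
  by rewrite ler_wpM2l// (le_trans (ler_normB _ _))// lerD.
- move=> /Be[+ _]; rewrite bE -(mulVf lL0) -/c -mulrBr normrM opprB addrA subrK.
  by rewrite ler_pdivlMr// mulrC.
- move=> vB; have [|_ +] := Be (- v); first by rewrite lerNr.
  by rewrite opprK bE normrM ler_pdivlMr// mulrC.
Qed.

(** A staircase over a mesh of [-c, c] with one smoothed step per cell, of height the increment of
    psi across it. At any point at most one step is in transition and costs up to d * C, the
    oscillation of psi in the cell costs d, and each remaining step leaves at most d * eta. *)
Lemma sigmoidal_approximation (u : X -> R) (psi : R -> R) :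
  (exists v, sigma v != 0) -> continuous psi ->
  (exists c : R, forall y, Y y -> `|u y| <= c) ->
  unif_closure Y (span [set p | exists a b, p = fun y => sigma (a * u y + b)])
    (psi \o u).
Proof.
move=> [v0 sv0] psic [c0 uc0]; set D0 := [set p | _].
have [c c1 uc] : exists2 c : R, 0 < c & forall y, Y y -> `|u y| <= c.
  by exists (`|c0| + 1) => [|y /uc0 h]; [rewrite ltr_wpDl|
    rewrite (le_trans h)// (le_trans (ler_norm _))// lerDl].
have Dsig a b : unif_closure Y (span D0) (fun y => sigma (a * u y + b)).
  by apply/unif_closure_incl/span_incl; exists a, b.
(* Slope 0 turns a dilate into the nonzero constant [sigma v0]. *)
have Dcst k : unif_closure Y (span D0) (fun=> k).
  rewrite (_ : (fun=> _) = fun y => k / sigma v0 * sigma (0 * u y + v0)).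
    exact: unif_closureZ.
  by apply/funext => y; rewrite mul0r add0r divfK.
have [C [C1 stepC]] := sigma_unit_step.
apply: unif_closure_idem => e e0; pose d := e / (2 * (1 + C)).
have C2 : 0 < 1 + C by lra.
have d0 : 0 < d by rewrite divr_gt0// mulr_gt0.
have [r r0 psir] : exists2 r, 0 < r & forall x h, `|x| <= c -> `|h| < r ->
    `|psi (x + h) - psi x| <= d.
  have := @near_compact_continuous R R R `[- c, c]%classic
    (fun hx => psi (hx.2 + hx.1)) 0 (@segment_compact R _ _).
  case/(_ _ d d0)/nbhs_ballP.
    move=> z; apply: continuous_comp; last exact: psic.
    by apply: cvgD; [exact: cvg_snd|exact: cvg_fst].
  move=> r /= r0 rP; exists r => // x h xc hr.
  have /rP/(_ x) : ball 0 r h by rewrite /ball/= sub0r normrN.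
  by rewrite /= in_itv/= -ler_norml addr0 => /(_ xc)/ltW.
pose n := (Num.truncn (2 * c / r)).+1; pose h := 2 * c / n%:R.
have n0 : 0 < n%:R :> R by rewrite ltr0n.
have h0 : 0 < h by rewrite divr_gt0// mulr_gt0.
have hr : h < r.
  by rewrite /h ltr_pdivrMr// (mulrC r) -ltr_pdivrMr//; exact: truncnS_gt.
(* The n residues d * eta add up to d * (1 + C) = e / 2, as much as the transition cell costs. *)
pose eta := (1 + C) / n%:R.
have eta0 : 0 < eta by rewrite divr_gt0.
have [k [a [b [stepb step1 step0]]]] := stepC _ eta0.
pose uu (i : nat) := - c + i%:R * h.
have uuS i : uu i.+1 = uu i + h by rewrite /uu -natr1 mulrDl mul1r addrA.
(* [N] follows [psi] up to the node [uu i] and stays near [psi (uu i)] beyond. *)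
suff /(_ n (leqnn n)) [N [ND Nl Nr]] : forall i, (i <= n)%N ->
   exists N, [/\ unif_closure Y (span D0) N,
    forall y, Y y -> u y <= uu i -> `|psi (u y) - N y| <= d * (1 + C) + i%:R * (d * eta) &
    forall y, Y y -> uu i <= u y -> `|N y - psi (uu i)| <= i%:R * (d * eta)].
  have uun : uu n = c by rewrite /uu /h mulrC divfK ?gt_eqF//; lra.
  have d1C : d * (1 + C) = e / 2 by rewrite /d; field; rewrite gt_eqF.
  move: Nl; rewrite uun mulrCA (mulrCA n%:R) /eta divff ?gt_eqF// mulr1 d1C -splitr => Nl.
  by exists N => // y Yy; apply: Nl => //; have := uc _ Yy; rewrite ler_norml => /andP[].
have deta : 0 <= d * eta by rewrite mulr_ge0// ltW.
elim => [_|i IH ltin].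
  have uu0 : uu 0 = - c by rewrite /uu mul0r addr0.
  exists (fun=> psi (- c)); split => //; rewrite uu0 mul0r.
  - move=> y Yy uyc; have := uc _ Yy; rewrite ler_norml => /andP[uyc' _].
    have -> : u y = - c by apply/eqP; rewrite eq_le uyc.
    by rewrite subrr normr0 addr0 mulr_ge0 ?ltW.
  - by move=> y _ _; rewrite subrr normr0.
have [N [ND Nl Nr]] := IH (ltnW ltin).
(* The step is centred in its cell, and [lam] is steep enough for half a cell to carry the argument
   to [|a|], past the threshold whatever the sign of [a]. *)
pose m := uu i + h / 2; pose lam := 2 * `|a| / h.
pose s y := b + k * sigma (lam * u y + (- (lam * m))).
pose D := psi (uu i.+1) - psi (uu i).
have nh : n%:R * h = 2 * c by rewrite /h mulrC divfK ?gt_eqF.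
have uui : `|uu i| <= c.
  have ih0 : 0 <= i%:R * h by rewrite mulr_ge0// ltW.
  have ih : i%:R * h <= n%:R * h by rewrite ler_pM2r// ler_nat ltnW.
  by rewrite ler_norml /uu; lra.
have Dd : `|D| <= d by rewrite /D uuS psir// gtr0_norm.
have sD : unif_closure Y (span D0) s.
  by apply: unif_closureD; [exact: Dcst|apply: unif_closureZ; exact: Dsig].
have lamE y : lam * u y + - (lam * m) = lam * (u y - m) by rewrite mulrBr.
have lam0 : 0 <= lam by rewrite divr_ge0 ?mulr_ge0// ltW.
have s0 y : u y <= uu i -> `|s y| <= eta.
  move=> uyi; apply: step0; rewrite lamE.
  apply: (@le_trans _ _ (- `|a|)); last by rewrite lerN2 ler_norm.
  have -> : - `|a| = lam * (- (h / 2)) by rewrite /lam; field; rewrite gt_eqF.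
  by rewrite ler_wpM2l// /m; lra.
have s1 y : uu i.+1 <= u y -> `|s y - 1| <= eta.
  move=> uyi; apply: step1; rewrite lamE.
  apply: (@le_trans _ _ `|a|); first by rewrite ler_norm.
  have -> : `|a| = lam * (h / 2) by rewrite /lam; field; rewrite gt_eqF.
  by rewrite ler_wpM2l// /m; move: uyi; rewrite uuS; lra.
have Deta x : `|x| <= eta -> `|D * x| <= d * eta by move=> ?; rewrite normrM ler_pM.
have iS : i.+1%:R * (d * eta) = i%:R * (d * eta) + d * eta.
  by rewrite -natr1 mulrDl mul1r.
have ide : 0 <= i%:R * (d * eta) by rewrite mulr_ge0.
exists (fun y => N y + D * s y); split.
- by apply: unif_closureD => //; exact: unif_closureZ.
- move=> y Yy uyi; rewrite iS; have [uylt|uyge] := leP (u y) (uu i).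
    have := Nl _ Yy uylt; have := Deta _ (s0 _ uylt).
    by rewrite !ler_norml; lra.
  have := Nr _ Yy (ltW uyge).
  have : `|D * s y| <= d * C by rewrite normrM; apply: ler_pM => //; exact: stepb.
  have : `|psi (u y) - psi (uu i)| <= d.
    have -> : psi (u y) = psi (uu i + (u y - uu i)) by rewrite addrC subrK.
    apply: psir => //; apply: le_lt_trans hr.
    by rewrite gtr0_norm ?subr_gt0// lerBlDl -uuS.
  by rewrite !ler_norml; nra.
- move=> y Yy uyi; rewrite iS.
  have := Nr _ Yy; have := Deta _ (s1 _ uyi).
  have -> : N y + D * s y - psi (uu i.+1) = N y - psi (uu i) + D * (s y - 1).
    by rewrite /D; ring.
  move=> h1 h2; rewrite (le_trans (ler_normD _ _))// lerD// h2//.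
  by rewrite (le_trans _ uyi)// uuS lerDl ltW.
Qed.




End SigmoidalApproximation.

(** * Networks and the hidden state recursion *)

Lemma continuous_sum {R : realType} (V : topologicalType) (I : Type)
    (r : seq I) (P : pred I) (F : I -> V -> R) :
  (forall i, continuous (F i)) ->
  continuous (fun v => \sum_(i <- r | P i) F i v).
Proof.
move=> Fc; elim: r => [|i r IH].
  rewrite (_ : (fun v => _) = fun=> 0); first by move=> v; exact: cvg_cst.
  by apply/funext => v; rewrite big_nil.
rewrite (_ : (fun v => _) = fun v =>
  (if P i then F i v else 0) + \sum_(i <- r | P i) F i v).
  move=> v; apply: cvgD; last exact: IH.
  by case: (P i); [exact: Fc|exact: cvg_cst].
by apply/funext => v; rewrite big_cons; case: ifP => // _; rewrite add0r.
Qed.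

Lemma compact_continuous_bounded {R : realType} (X : topologicalType)
    (Y : set X) (u : X -> R) : compact Y -> continuous u ->
  exists c : R, forall y, Y y -> `|u y| <= c.
Proof.
move=> Yc uc; have : compact (u @` Y).
  by apply: continuous_compact => //; exact: continuous_subspaceT.
move/compact_bounded => [C [_ pC]]; exists (C + 1) => y Yy.
by apply: (pC (C + 1)); [rewrite ltrDl|exists y].
Qed.

Section Networks.
Context {R : realType} (X : topologicalType) (Y : set X) (n : nat).
Variables (sigma : R -> R) (z : 'I_n -> X -> R).

Definition neuron (q : 'I_n.+1 -> R) (y : X) : R :=
  sigma (\sum_(m < n) q (lift ord0 m) * z m y + q ord0).

Hypotheses (sigma_sig : sigmoidal sigma) (sigma_neq0 : exists v, sigma v != 0).
Hypotheses (Yc : compact Y) (zc : forall m, continuous (z m)).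
Hypothesis z_inj : forall x y, Y x -> Y y -> (forall m, z m x = z m y) -> x = y.

(** The zero form yields the constants, and the exponentials of single coordinates separate points
    by joint injectivity of the [z m]. A dilate of sigma applied to a multiple of a linear form plus
    a shift is itself a neuron, so the one-variable approximation of [expR] finishes. *)
Lemma neuron_dense (F : X -> R) : continuous F ->
  unif_closure Y (span [set p | exists q : 'rV_n.+1, p = neuron (q ord0)]) F.
Proof.
move=> Fc; set D := [set p | _].
pose dot (a : 'I_n -> R) y := \sum_(m < n) a m * z m y.
have dotc a : continuous (dot a).
  apply: continuous_sum => m y; apply: cvgM; [exact: cvg_cst|exact: zc].
pose E : set (X -> R) := [set p | exists a, p = fun y => expR (dot a y)].
have : unif_closure Y (span E) F.
  apply: stone_weierstrass => //.
  - move=> p; elim => [|c r G [a ->] _ IH] y; first exact: cvg_cst.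
    apply: cvgD; last exact: IH.
    apply: cvgM; first exact: cvg_cst.
    apply: continuous_comp; [exact: dotc|exact: continuous_expR].
  - move=> c; rewrite (_ : (fun=> c) = fun y => c * expR (dot (fun=> 0) y)).
      by apply/spanZ/span_incl; exists (fun=> 0).
    by apply/funext => y; rewrite /dot big1 ?expR0 ?mulr1// => i _; rewrite mul0r.
  - by move=> p q; exact: spanD.
  - move=> p q; apply: spanM => _ _ [a ->] [b ->].
    exists (fun m => a m + b m); apply/funext => y.
    rewrite -expRD /dot -big_split/=; congr expR.
    by apply: eq_bigr => i _; rewrite mulrDl.
  - move=> x y Yx Yy xy; have /existsNP[m zm] : ~ forall m, z m x = z m y.
      by move=> /(z_inj Yx Yy).
    exists (fun y => expR (dot (fun m' => (m' == m)%:R) y)).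
      by apply: span_incl; exists (fun m' => (m' == m)%:R).
    have dotE v : dot (fun m' => (m' == m)%:R) v = z m v.
      rewrite /dot (bigD1 m)//= eqxx mul1r big1 ?addr0// => i /negbTE ->.
      by rewrite mul0r.
    by rewrite !dotE => /expR_inj.
apply: unif_closure_span => _ [a ->].
have := @sigmoidal_approximation R X Y sigma sigma_sig (dot a) expR sigma_neq0.
move=> /(_ (@continuous_expR R) (compact_continuous_bounded Yc (dotc a))).
apply: unif_closure_span => _ [l [b ->]].
apply/unif_closure_incl/span_incl.
exists (\row_i (if unlift ord0 i is Some m then l * a m else b)).
apply/funext => y; rewrite /neuron mxE unlift_none /dot mulr_sumr; congr sigma.
by congr (_ + _); apply: eq_bigr => m _; rewrite mxE liftK mulrA.
Qed.

End Networks.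

Section HiddenState.
Context {R : realType} (n d : nat) (sigma : R -> R).

(** The last block of the state evolves on its own, since no other block feeds into it; [b s] is the
    input injected at time s. *)
Fixpoint hidden (A : 'M[R]_n) (b : nat -> 'cV[R]_n) (t : nat) : 'cV[R]_n :=
  if t is s.+1 then
    hidden A b s + map_mx sigma (A *m hidden A b s) + b s
  else 0.

Lemma continuous_hidden (V : topologicalType) (A : V -> 'M[R]_n)
    (b : V -> nat -> 'cV[R]_n) : continuous sigma ->
  (forall i j, continuous (fun v => A v i j)) ->
  (forall s i, continuous (fun v => b v s i 0)) ->
  forall t m, continuous (fun v => hidden (A v) (b v) t m 0).
Proof.
move=> sc Ac bc; elim => [|t IH] m /=.
  by move=> v; under eq_fun do rewrite mxE; exact: cvg_cst.
under eq_fun do rewrite !mxE.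
move=> v; apply: cvgD; last exact: bc.
apply: cvgD; first exact: IH.
apply: continuous_comp; last exact: sc.
apply: continuous_sum => k {}v; apply: cvgM; [exact: Ac|exact: IH].
Qed.

Hypotheses (sigma_inj : injective sigma) (sigma0 : sigma 0 = 0) (d0 : (0 < d)%N).
Variable A : 'M[R]_n.
(** Row i of A_1^{(2)} is row i - d of U, so upper triangularity of U reads i <= j + d, and the
    diagonal of U sits on the subdiagonal i = j + d. *)
Hypothesis A_upper : forall i j : 'I_n, A i j != 0 -> (i <= j + d)%N.
Hypothesis A_diag : forall i j : 'I_n, i = (j + d)%N :> nat -> A i j != 0.

(** One update moves the support down by at most d rows: row k of [A] sees only columns from k - d
    on, and [sigma 0 = 0] keeps vanishing rows at zero. *)
Lemma hidden_support (b : nat -> 'cV[R]_n) t (k : 'I_n) :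
  (forall s (m : 'I_n), (d <= m)%N -> b s m 0 = 0) ->
  (t * d <= k)%N -> hidden A b t k 0 = 0.
Proof.
move=> b0; elim: t k => [|t IH] k /=; rewrite !mxE// mulSn => tk.
rewrite IH ?b0 ?(leq_trans _ tk) ?leq_addr ?leq_addl// big1 ?sigma0 ?addr0// => j _.
have [->|/A_upper kj] := eqVneq (A k j) 0; first by rewrite mul0r.
by rewrite IH ?mulr0// -(leq_add2r d) (leq_trans _ kj)// addnC.
Qed.

(* Descending induction on the index: row [k + d] of an update determines entry
   [k] of the previous state once its entries beyond [k] are known. *)
Lemma hidden_inj (b b' : nat -> 'cV[R]_n) (t : nat) :
  (t.+1 * d <= n)%N ->
  (forall s (m : 'I_n), (d <= m)%N -> b s m 0 = 0) ->
  (forall s (m : 'I_n), (d <= m)%N -> b' s m 0 = 0) ->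
  hidden A b t = hidden A b' t -> forall s, (s < t)%N -> b s = b' s.
Proof.
move=> + b0 b0'; elim: t => // t IH tn /= eqh.
suff eqt : hidden A b t = hidden A b' t.
  move=> s; rewrite ltnS leq_eqVlt => /predU1P[->|st].
    by move: eqh; rewrite eqt => /addrI.
  by apply: IH => //; apply: leq_trans tn; rewrite leq_mul2r leqnSn orbT.
suff H : forall j (k : 'I_n), (n <= k + j)%N ->
    hidden A b t k 0 = hidden A b' t k 0.
  by apply/colP => k; apply: (H n); rewrite leq_addl.
elim => [k|j IHj k nk]; first by rewrite addn0 leqNgt ltn_ord.
(* Entries from t * d on vanish in both states. For smaller k, row k + d still exists, thanks to the
   spare block in the size hypothesis. *)
have [tk|kt] := leqP (t * d) k; first by rewrite !hidden_support.
have kdn : (k + d < n)%N.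
  by apply: leq_trans tn; rewrite !mulSn addnC ltn_add2l ltn_addl.
pose m := Ordinal kdn.
have IHk i : (k < i)%N -> forall i' : 'I_n, i' = i :> nat ->
    hidden A b t i' 0 = hidden A b' t i' 0.
  move=> ki i' i'i; apply: IHj; rewrite i'i.
  by apply: leq_trans nk _; rewrite addnS -addSn leq_add2r.
(* Row m = k + d receives no input, and its old entry is known because m > k. After cancelling it
   and inverting sigma, terms with i < k vanish by [A_upper], those with i > k are known, and
   [A_diag] isolates entry k. *)
move/matrixP : eqh => /(_ m 0); rewrite !mxE b0 ?b0' /= ?leq_addl// !addr0.
have km : (k < m)%N by rewrite /= -[X in (X < _)%N]addn0 ltn_add2l.
rewrite (IHk m km m erefl).
move=> /addrI/sigma_inj.
rewrite (bigD1 k)//= [RHS](bigD1 k)//=.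
have -> : \sum_(i < n | i != k) A m i * hidden A b t i 0 =
  \sum_(i < n | i != k) A m i * hidden A b' t i 0.
  apply: eq_bigr => i ik; have [->|/A_upper /=] := eqVneq (A m i) 0.
    by rewrite !mul0r.
  rewrite leq_add2r leq_eqVlt eq_sym => /orP[/eqP/val_inj/eqP|ki].
    by rewrite (negbTE ik).
  by rewrite (IHk i ki i erefl).
by move=> /addIr/mulfI; apply; exact: A_diag.
Qed.

End HiddenState.

(** * The last block of the state *)

Lemma continuous_entry {R : realType} (V : topologicalType) (m n : nat)
    (f : V -> 'M[R]_(m, n)) i j :
  continuous f -> continuous (fun v => f v i j).
Proof.
move=> fc v.
apply: (@continuous_comp _ _ _ f (fun M : 'M[R]_(m, n) => M i j)).
  exact: fc.
exact: coord_continuous.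
Qed.

Section ScaledStream.
Context {R : realType} (d T' : nat) (sigma : R -> R).

(** This is [schemeA12] with U as a free variable, so that U can range over a compact set. *)
Definition shift_mx (U : 'M[R]_(T' * d)) : 'M[R]_(T'.+1 * d) :=
  castmx (esym (mulSn T' d), esym (mulSnr T' d))
    (block_mx (0 : 'M[R]_(d, T' * d)) (0 : 'M[R]_(d, d))
              U                       (0 : 'M[R]_(T' * d, d))).

(** The quantifier over U sits inside each case because continuity in U needs a case split on the
    position alone. *)
Lemma shift_mxP (m k : 'I_(T'.+1 * d)) :
  ((m < d)%N || (T' * d <= k)%N /\ forall U, shift_mx U m k = 0) \/
  exists j l : 'I_(T' * d), [/\ m = (d + j)%N :> nat, k = l :> nat &
    forall U, shift_mx U m k = U j l].
Proof.
have E U : shift_mx U m k = block_mx (0 : 'M[R]_(d, T' * d)) (0 : 'M[R]_(d, d))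
    U (0 : 'M[R]_(T' * d, d)) (cast_ord (mulSn T' d) m) (cast_ord (mulSnr T' d) k).
  by rewrite castmxE !esymK.
have : m = cast_ord (mulSn T' d) m :> nat by [].
have : k = cast_ord (mulSnr T' d) k :> nat by [].
case: (split_ordP (cast_ord (mulSn T' d) m)) E => i mi;
  case: (split_ordP (cast_ord (mulSnr T' d) k)) => l kl E; rewrite mi kl /=.
- move=> _ _; left; split=> // U; rewrite E mi kl.
  by rewrite block_mxEul mxE.
- move=> _ _; left; split=> // U; rewrite E mi kl.
  by rewrite block_mxEur mxE.
- move=> kE mE; right; exists i, l; split => // U.
  by rewrite E mi kl block_mxEdl.
- move=> kE _; left; split; first by rewrite kE leq_addr.
  by move=> U; rewrite E mi kl block_mxEdr mxE.
Qed.

(** The last block of A_2^i h + xi_2^i is alpha_i e_i; since [sigma 0 = 0], applying sigma and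
    multiplying by x_s^i leaves only sigma(alpha_i) x_s^i in entry i. *)
Definition drive (al : 'I_d -> R) (xs : nat -> 'I_d -> R) (s : nat) :
    'cV[R]_(T'.+1 * d) :=
  col_mx (\col_i (sigma (al i) * xs s i)) (0 : 'cV[R]_(T' * d)).

Lemma driveP (k : 'I_(T'.+1 * d)) :
  ((d <= k)%N /\ forall al xs s, drive al xs s k 0 = 0) \/
  exists2 i : 'I_d, k = i :> nat &
    forall al xs s, drive al xs s k 0 = sigma (al i) * xs s i.
Proof.
case: (@split_ordP d (T' * d) k) => i ->.
  by right; exists i => // al xs s; rewrite /drive col_mxEu mxE.
by left; split=> [|al xs s]; [exact: leq_addr|rewrite /drive col_mxEd mxE].
Qed.

Lemma drive_lshift al xs s (i : 'I_d) :
  drive al xs s (lshift (T' * d) i) 0 = sigma (al i) * xs s i.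
Proof. by rewrite /drive col_mxEu mxE. Qed.

(* The junk value [0] is only taken for [s >= T']. *)
Definition stream (y : 'M[R]_(T', d)) (s : nat) (i : 'I_d) : R :=
  if insub s is Some r then y r i else 0.

Definition last_block (th : 'M[R]_(T' * d) * 'rV[R]_d) (y : 'M[R]_(T', d)) :
    'cV[R]_(T'.+1 * d) :=
  hidden sigma (shift_mx th.1) (drive (th.2 ord0) (stream y)) T'.

Definition nondegenerate (th : 'M[R]_(T' * d) * 'rV[R]_d) : Prop :=
  [/\ forall j l : 'I_(T' * d), (l < j)%N -> th.1 j l = 0,
      forall j, th.1 j j != 0 & forall i, th.2 ord0 i != 0].

Definition cell (q : 'I_(T'.+1 * d).+1 -> R) th : 'M[R]_(T', d) -> R :=
  neuron sigma (fun m y => last_block th y m 0) q.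

Hypotheses (d0 : (0 < d)%N) (sigma_inj : injective sigma) (sigma0 : sigma 0 = 0)
  (sigma_cont : continuous sigma).

(** The T * d rows are exactly the room that T - 1 shifts by d require, so all inputs are recovered
    from the state; the factors sigma(alpha_i) are nonzero and cancel. *)
Lemma last_block_inj th : nondegenerate th -> injective (last_block th).
Proof.
move=> [Uup Udiag al0] y y' eqZ.
have dr0 xs s (m : 'I_(T'.+1 * d)) : (d <= m)%N -> drive (th.2 ord0) xs s m 0 = 0.
  move=> dm; case: (driveP m) => [[_ ->]//|[i mi]].
  by move: dm; rewrite mi leqNgt ltn_ord.
have A_upper (m k : 'I_(T'.+1 * d)) : shift_mx th.1 m k != 0 -> (m <= k + d)%N.
  case: (shift_mxP m k) => [[_ ->]|[j [l [mj kl ->]]]]; first by rewrite eqxx.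
    by rewrite mj kl addnC leq_add2r; apply: contraR; rewrite -ltnNge => /Uup ->.
have A_diag (m k : 'I_(T'.+1 * d)) : m = (k + d)%N :> nat -> shift_mx th.1 m k != 0.
  move=> mk; case: (shift_mxP m k) => [[+ _]|[j [l [mj kl ->]]]].
      rewrite mk ltnNge leq_addl/= => kT.
      have : (k + d < d + T' * d)%N by rewrite -mk; exact: (ltn_ord m).
    by rewrite [X in (_ < X)%N]addnC ltn_add2r ltnNge kT.
    suff -> : j = l by exact: Udiag.
    by apply: val_inj; apply/eqP; rewrite /= -(eqn_add2l d) -mj -kl mk addnC.
have dreq := @hidden_inj R (T'.+1 * d) d sigma sigma_inj sigma0 d0 (shift_mx th.1)
  A_upper A_diag _ _ T' (leqnn _) (dr0 (stream y)) (dr0 (stream y')) eqZ.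
apply/matrixP => s i.
have /matrixP/(_ (lshift (T' * d) i) 0) := dreq s (ltn_ord s).
rewrite !drive_lshift /stream insubT//= => [sT].
rewrite (_ : Sub _ _ = s); last exact: val_inj.
apply: mulfI; rewrite -sigma0; apply/eqP => /sigma_inj/eqP.
exact/negP.
Qed.

Lemma continuous_last_block (V : topologicalType)
    (th : V -> 'M[R]_(T' * d) * 'rV[R]_d) (y : V -> 'M[R]_(T', d)) m :
  continuous th -> continuous y ->
  continuous (fun v => last_block (th v) (y v) m 0).
Proof.
move=> thc yc.
have th1c : continuous (fun v => (th v).1).
  by move=> v; apply: continuous_comp; [exact: thc|exact: cvg_fst].
have th2c : continuous (fun v => (th v).2).
  by move=> v; apply: continuous_comp; [exact: thc|exact: cvg_snd].
apply: continuous_hidden => //.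
- move=> i j; case: (shift_mxP i j) => [[_ E]|[k [l [_ _ E]]]].
    by under eq_fun do rewrite E; move=> v; exact: cvg_cst.
  by under eq_fun do rewrite E; exact: continuous_entry.
- move=> s i; case: (driveP i) => [[_ E]|[k _ E]].
    by under eq_fun do rewrite E; move=> v; exact: cvg_cst.
  under eq_fun do rewrite E.
  move=> v; apply: cvgM.
    apply: continuous_comp; last exact: sigma_cont.
    exact: continuous_entry.
  rewrite /stream; case: insub => [r|]; last exact: cvg_cst.
  exact: continuous_entry.
Qed.

Lemma continuous_cell (V : topologicalType)
    (q : V -> 'rV[R]_(T'.+1 * d).+1) (th : V -> 'M[R]_(T' * d) * 'rV[R]_d)
    (y : V -> 'M[R]_(T', d)) :
  continuous q -> continuous th -> continuous y ->
  continuous (fun v => cell (q v ord0) (th v) (y v)).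
Proof.
move=> qc thc yc v; apply: continuous_comp; last exact: sigma_cont.
apply: cvgD; last exact: continuous_entry.
move: v; apply: continuous_sum => m v; apply: cvgM; first exact: continuous_entry.
exact: continuous_last_block.
Qed.

(** A target is an open box of neuron weights, coded as its centre and half-width. *)
Definition hits (M : nat) (p : 'I_M -> 'I_(T'.+1 * d).+1 -> R)
    (t : 'rV[R]_(T'.+1 * d).+1 * R) : Prop :=
  exists k, forall i, `|p k i - t.1 ord0 i| < t.2.

Variable Y : set 'M[R]_(T', d).
Hypotheses (Yc : compact Y) (sigma_bnd : exists C : R, forall v, `|sigma v| <= C).

(** Each term c * cell q of the span gets one box around q. Half of e pays for moving the weights
    inside this box and the parameters near [th], with |c| + 1 avoiding division by 0; the other
    half goes to the remaining terms. *)
Let span_targets th (G : 'M[R]_(T', d) -> R) :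
  span [set p | exists q : 'rV_(T'.+1 * d).+1, p = cell (q ord0) th] G ->
  forall e, 0 < e -> exists L : seq ('rV[R]_(T'.+1 * d).+1 * R),
    (forall t, t \in L -> 0 < t.2) /\
    \forall th' \near th, forall M (p : 'I_M -> 'I_(T'.+1 * d).+1 -> R),
      (forall t, t \in L -> hits p t) ->
      exists w : 'I_M -> R, forall y, Y y ->
        `|G y - \sum_(k < M) w k * cell (p k) th' y| <= e.
Proof.
elim => [e e0|c r F [q ->] _ IH e e0].
  exists [::]; split => //.
  apply: (@filterE _ (nbhs th)) => th' M p _; exists (fun=> 0) => y _.
  by rewrite big1 ?subr0 ?normr0 ?ltW// => i _; rewrite mul0r.
have e20 : 0 < e / 2 by rewrite divr_gt0.
have c0 : 0 < `|c| + 1 by rewrite ltr_wpDl.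
have [L [L0 LF]] := IH _ e20.
have ec0 : 0 < e / 2 / (`|c| + 1) by rewrite divr_gt0.
have := @near_compact_continuous R _ _ Y
  (fun p : (('M[R]_(T' * d) * 'rV[R]_d) * 'rV[R]_(T'.+1 * d).+1) * 'M[R]_(T', d)
     => cell (p.1.2 ord0) p.1.1 p.2) (th, q) Yc.
case/(_ _ _ ec0) => [|[U W] /= UWn UW]; last case: UWn => Uth Wq.
  apply: continuous_cell; first by move=> v;
      apply: continuous_comp; [exact: cvg_fst|exact: cvg_snd].
    by move=> v; apply: continuous_comp; [exact: cvg_fst|exact: cvg_fst].
  by move=> v; exact: cvg_snd.
have /nbhs_ballP[rad /= rad0 radW] := Wq.
exists ((q, rad) :: L); split.
  by move=> t; rewrite inE => /predU1P[->//|/L0].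
apply: filterS2 Uth LF => th' Uth' LFth' M p pL.
have [k kq] : hits p (q, rad) by apply: pL; rewrite inE eqxx.
have [|w wF] := LFth' M p.
  by move=> t tL; apply: pL; rewrite inE tL orbT.
(* The neuron hitting the new box may already serve other terms, so c is added to its output
   weight. *)
exists (fun k' => w k' + (k' == k)%:R * c) => y Yy.
have -> : \sum_(k0 < M) (w k0 + (k0 == k)%:R * c) * cell (p k0) th' y =
    c * cell (p k) th' y + \sum_(k0 < M) w k0 * cell (p k0) th' y.
  under eq_bigr do rewrite mulrDl.
  rewrite big_split/= addrC; congr (_ + _).
  rewrite (bigD1 k)//= eqxx mul1r big1 ?addr0// => i /negbTE ->.
  by rewrite !mul0r.
have : `|cell (q ord0) th y - cell (p k) th' y| <= e / 2 / (`|c| + 1).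
  have /= := UW (th', \row_i p k i) (conj Uth' _) y Yy.
  rewrite (_ : (\row_i p k i) ord0 = p k); last by apply/funext => i; rewrite mxE.
  rewrite distrC => /(_ _)/ltW; apply; apply: radW; split => // i j.
  by rewrite ord1 mxE /ball/= distrC; exact: kq.
have := wF _ Yy.
set a := cell _ th y; set b := cell _ th' y; set s := \sum_(_ < _) _.
move=> h1; rewrite ler_pdivlMr// [X in X <= _]mulrC => h2.
have -> : c * a + F y - (c * b + s) = c * (a - b) + (F y - s) by ring.
rewrite (le_trans (ler_normD _ _))// (splitr e); apply: lerD h1.
by rewrite normrM; apply: le_trans h2; rewrite ler_wpM2r// lerDl.
Qed.

(** Boxes that work at one parameter work nearby, and lists of boxes may be concatenated, so
    compactness of [Th] yields one list for all of [Th]. Only the output weights depend on [th]. *)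
Lemma uniform_targets (Th : set ('M[R]_(T' * d) * 'rV[R]_d))
    (F : 'M[R]_(T', d) -> R) (e : R) :
  compact Th -> (forall th, Th th -> nondegenerate th) -> continuous F -> 0 < e ->
  exists L : seq ('rV[R]_(T'.+1 * d).+1 * R),
    (forall t, t \in L -> 0 < t.2) /\
    forall th, Th th -> forall M (p : 'I_M -> 'I_(T'.+1 * d).+1 -> R),
      (forall t, t \in L -> hits p t) ->
      exists w : 'I_M -> R, forall y, Y y ->
        `|F y - \sum_(k < M) w k * cell (p k) th y| <= e.
Proof.
move=> Thc Thn Fc e0.
apply: (@compact_ind _ Th (fun B => exists L : seq ('rV[R]_(T'.+1 * d).+1 * R),
    (forall t, t \in L -> 0 < t.2) /\
    forall th, B th -> forall M (p : 'I_M -> 'I_(T'.+1 * d).+1 -> R),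
      (forall t, t \in L -> hits p t) ->
      exists w : 'I_M -> R, forall y, Y y ->
        `|F y - \sum_(k < M) w k * cell (p k) th y| <= e)) => //.
- by exists [::]; split.
- by move=> B C BC [L [L0 LC]]; exists L; split => // th /BC; exact: LC.
- move=> B C [L [L0 LB]] [L' [L'0 LC]]; exists (L ++ L'); split.
    by move=> t; rewrite mem_cat => /orP[/L0|/L'0].
  move=> th [/LB H|/LC H] M p pL; apply: H => t tL; apply: pL;
    by rewrite mem_cat tL ?orbT.
- move=> th /Thn thn; have e20 : 0 < e / 2 by rewrite divr_gt0.
  have sv : exists v, sigma v != 0.
    by exists 1; rewrite -sigma0; apply/eqP => /sigma_inj/eqP; rewrite oner_eq0.
  have := @neuron_dense R _ Y _ sigma (fun m y => last_block th y m 0)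
    (continuous_injective_sigmoidal sigma_cont sigma_inj sigma_bnd) sv Yc.
  case/(_ _ _ F Fc _ e20).
  + move=> m; apply: (@continuous_last_block _ (fun=> th) id) => y.
      exact: cst_continuous.
    exact: cvg_id.
  + by move=> x y _ _ xy; apply: (last_block_inj thn); apply/colP.
  move=> G GD FG; have [L [L0 LG]] := span_targets GD e20.
  exists [set th' | forall M (p : 'I_M -> 'I_(T'.+1 * d).+1 -> R),
      (forall t, t \in L -> hits p t) ->
      exists w : 'I_M -> R, forall y, Y y ->
        `|G y - \sum_(k < M) w k * cell (p k) th' y| <= e / 2] => //.
  exists L; split => // th' H M p /H[w wG]; exists w => y Yy.
  have := FG _ Yy; have := wG _ Yy; rewrite !ler_norml; lra.
Qed.

End ScaledStream.

(** * Independence and union bounds *)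

Section Independence.
Context {R : realType} (disp : measure_display) (Omega : measurableType disp).
Variable P : probability Omega R.
Local Open Scope ereal_scope.

Lemma mutually_independent_fin (I : Type) (X : I -> {RV P >-> R}) (J : finType)
    (s : J -> I) (B : J -> set R) :
  mutually_independent X -> injective s -> (forall j, measurable (B j)) ->
  P (\bigcap_(j in [set: J]) X (s j) @^-1` B j) =
  \prod_(j : J) P (X (s j) @^-1` B j).
Proof.
move=> Xind s_inj mB.
transitivity (P (\bigcap_(k in [set: 'I_#|J|])
    X (s (enum_val k)) @^-1` B (enum_val k))).
  congr (P _); apply/seteqP; split => w h j _; first exact: h.
  by have := h (enum_rank j) Logic.I; rewrite /= enum_rankK.
rewrite (Xind _ (s \o enum_val) (B \o enum_val)) => [||k]; last exact: mB.
  by rewrite [RHS](reindex (@enum_val J J))//; exact/onW_bij/enum_val_bij.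
exact/inj_comp/enum_val_inj.
Qed.

Lemma independent_complements (I : eqType) (A : I -> set Omega) (p : R) :
  (forall i, measurable (A i)) ->
  (forall s, uniq s -> P (\big[setI/setT]_(i <- s) A i) = (p ^+ size s)%:E) ->
  forall s, uniq s -> P (\big[setI/setT]_(i <- s) ~` A i) = ((1 - p) ^+ size s)%:E.
Proof.
move=> mA PA.
have mbig (F : I -> set Omega) s : (forall i, measurable (F i)) ->
    measurable (\big[setI/setT]_(i <- s) F i).
  by move=> mF; apply: bigsetI_measurable.
(* Complements are traded one at a time: P (C `\` A) = P C - P (C `&` A). *)
have H s1 : forall s2, uniq (s1 ++ s2) ->
    P (\big[setI/setT]_(i <- s1) ~` A i `&` \big[setI/setT]_(i <- s2) A i) =
    ((1 - p) ^+ size s1 * p ^+ size s2)%:E.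
  elim: s1 => [s2 us2|i s1 IH s2].
    by rewrite big_nil setTI PA// mul1r.
  rewrite cat_cons => us; rewrite big_cons.
  have us12 : uniq (s1 ++ s2) by case/andP: us.
  have us12' : uniq (s1 ++ i :: s2).
    by rewrite (perm_uniq (permEl (perm_catCA s1 [:: i] s2))).
  set C := \big[setI/setT]_(i <- s1) _; set D := \big[setI/setT]_(i <- s2) _.
  have -> : (~` A i `&` C) `&` D = (C `&` D) `\` A i.
    by rewrite setDE -setIA setIC.
  rewrite measureD//; [|by apply: measurableI; apply: mbig => // j; exact: measurableC|].
    have := IH _ us12'; rewrite big_cons -/C -/D.
    rewrite (_ : C `&` D `&` A i = C `&` (A i `&` D)); last first.
      by rewrite -setIA (setIC D).
    move=> PE; transitivity (((1 - p) ^+ size s1 * p ^+ size s2)%:E -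
        ((1 - p) ^+ size s1 * p ^+ (size s2).+1)%:E).
      by congr (_ - _); [exact: IH|exact: PE].
    by rewrite -EFinB /= !exprS; congr _%:E; ring.
  rewrite (le_lt_trans (probability_le1 _ _)) ?ltry//.
  by apply: measurableI; apply: mbig => // j; exact: measurableC.
move=> s us; have := H s [::]; rewrite cats0 => /(_ us).
by rewrite big_nil setIT mulr1.
Qed.

(** Distinct neurons use disjoint sets of coordinates, so the events that they land in the box are
    independent, and so are the complements. *)
Lemma miss_probability (I : Type) (X : I -> {RV P >-> R}) (M m : nat)
    (idx : 'I_M -> 'I_m -> I) (B : 'I_m -> set R) (p : R) :
  mutually_independent X -> (forall i, measurable (B i)) ->
  (forall k l i j, idx k i = idx l j -> k = l /\ i = j) ->
  (forall k, \prod_(i < m) P (X (idx k i) @^-1` B i) = p%:E) ->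
  P [set omega | forall k, ~ forall i, B i (X (idx k i) omega)] =
    ((1 - p) ^+ M)%:E.
Proof.
move=> Xind mB idx_inj Pp.
pose A k : set Omega := [set omega | forall i, B i (X (idx k i) omega)].
have mX k i : measurable (X (idx k i) @^-1` B i).
  by rewrite -[X in measurable X]setTI; exact: measurable_funP.
have AE k : A k = \bigcap_(i in [set: 'I_m]) X (idx k i) @^-1` B i.
  by apply/seteqP; split => w /= h i; [move=> _|]; exact: h.
have mA k : measurable (A k).
  by rewrite AE; apply: fin_bigcap_measurable => // i _; exact: mX.
have := @independent_complements _ A p mA _ (enum 'I_M) (enum_uniq _).
rewrite size_enum_ord => <-.
  congr (P _); rewrite -bigcap_seq; apply/seteqP; split => w /= h k.
    by move=> _; exact: h.
  by apply: h; rewrite /= mem_enum.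
(* Neurons outside [s] receive the trivial set [setT], so a single independent family indexed by the
   whole grid suffices. *)
move=> s us; have := @mutually_independent_fin _ X ('I_M * 'I_m)%type
  (fun ki => idx ki.1 ki.2) (fun ki => if ki.1 \in s then B ki.2 else setT) Xind.
rewrite (_ : \bigcap_(_ in _) _ = \big[setI/setT]_(k <- s) A k); last first.
  rewrite -bigcap_seq; apply/seteqP; split => w /= h.
    by move=> k /= ks i; have := h (k, i) Logic.I; rewrite /= ks.
  by move=> [k i] _ /=; case: ifP => // ks; exact: h.
move=> ->.
- rewrite (eq_bigr (fun ki => (fun k i =>
    if k \in s then P (X (idx k i) @^-1` B i) else 1) ki.1 ki.2)); last first.
    move=> [k i] _ /=; case: ifP => // _.
    by rewrite preimage_setT probability_setT.
  rewrite -(pair_bigA _ (fun k i => if k \in s then P (X (idx k i) @^-1` B i) else 1))/=.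
  rewrite (eq_bigr (fun k => if k \in s then p%:E else 1)); last first.
    by move=> k _; case: ifP => // _; rewrite big1.
  by rewrite -big_mkcond -big_uniq//= prodEFin big_const_seq count_predT iter_mulr_1.
- by move=> [k i] [l j] /= /idx_inj[-> ->].
- by move=> [k i] /=; case: ifP.
Qed.

Lemma union_bound (I : eqType) (A : I -> set Omega) (r : R) (s : seq I) :
  (forall i, i \in s -> measurable (A i) /\ P (~` A i) <= r%:E) ->
  measurable (\big[setI/setT]_(i <- s) A i) /\
  P (~` \big[setI/setT]_(i <- s) A i) <= ((size s)%:R * r)%:E.
Proof.
elim: s => [_|i s IH As].
  by rewrite big_nil setCT measure0 mul0r.
have [mi Pi] := As _ (mem_head _ _).
have [|IHm IHP] := IH; first by move=> j js; apply: As; rewrite inE js orbT.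
rewrite big_cons; split; first exact: measurableI.
rewrite setCI (le_trans (measureU2 _ _ _))//; [exact: measurableC|exact: measurableC|].
by rewrite /= -natr1 mulrDl mul1r addrC EFinD leeD.
Qed.

End Independence.

(** * Concentration of the sampling law on compact annuli *)

Section SamplingLaw.
Context {R : realType} (mu : probability (measurableTypeR R) R).
Local Open Scope ereal_scope.

Lemma compact_annulus (c C : R) : compact [set y : R | c <= `|y| <= C]%R.
Proof.
rewrite (_ : mkset _ = `[(- C)%R, C]%classic `&` [set y : R | c <= `|y|]%R).
  apply: compact_closedI; first exact: segment_compact.
  apply: (@preimage_closed _ _ (Num.norm : R -> R) [set y | c <= y]%R).
    by move=> y _; exact: norm_continuous.
  exact: closed_ge.
apply/seteqP; split => y /=; rewrite in_itv/= -ler_norml.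
  by move=> /andP[].
by move=> [-> ->].
Qed.

Lemma measurable_annulus (c C : R) :
  measurable ([set y | c <= `|y| <= C]%R : set (measurableTypeR R)).
Proof. by apply: compact_measurable; exact: compact_annulus. Qed.

(** The complements of the annuli 1/k <= |y| <= k decrease to {0}, a null set by absolute
    continuity; continuity from above concludes. *)
Lemma annulus_probability : mu `<< (@lebesgue_measure R) ->
  forall r : R, (0 < r)%R -> exists c C : R, (0 < c)%R /\
    mu (~` [set y | c <= `|y| <= C]%R) <= r%:E.
Proof.
move=> mu_ac r r0.
pose F (k : nat) : set (measurableTypeR R) :=
  ~` [set y | k.+1%:R^-1 <= `|y| <= k.+1%:R]%R.
have mF k : measurable (F k) by apply: measurableC; exact: measurable_annulus.
have F0 : \bigcap_k F k = [set 0%R].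
  apply/seteqP; split => y /=; last first.
    by move=> -> k _; rewrite /F/= normr0 leNgt invr_gt0 ltr0n.
  move=> Fy; apply: contrapT => /eqP y0; have y0' : (0 < `|y|)%R by rewrite normr_gt0.
  pose k := maxn (Num.truncn `|y|) (Num.truncn `|y|^-1).
  apply: (Fy k Logic.I); apply/andP; split.
    rewrite -[leRHS]invrK lef_pV2 ?posrE ?invr_gt0// ltW//.
    apply: lt_le_trans (truncnS_gt _) _.
    by rewrite ler_nat ltnS leq_maxr.
  rewrite ltW//; apply: lt_le_trans (truncnS_gt _) _.
  by rewrite ler_nat ltnS leq_maxl.
have muF : mu (F k) @[k --> \oo] --> mu (\bigcap_k F k).
  apply: nonincreasing_cvg_mu => //.
  - by rewrite (le_lt_trans (probability_le1 _ _)) ?ltry.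
  - by rewrite F0; exact: measurable_set1.
  - move=> k l kl; apply/subsetPset; apply: subsetC => y /= /andP[h1 h2].
    apply/andP; split.
      by apply: le_trans h1; rewrite lef_pV2 ?posrE// ler_nat ltnS.
    by apply: le_trans h2 _; rewrite ler_nat ltnS.
have mu0 : mu [set 0%R] = 0.
  move/null_content_dominatesP : mu_ac; apply; first exact: measurable_set1.
  exact: lebesgue_measure_set1.
move: muF; rewrite F0 mu0 => /fine_cvgP[_ /cvgrPdist_lt /(_ _ r0)[k _ /(_ k)]].
move=> /(_ (leqnn k)); rewrite sub0r normrN ger0_norm ?fine_ge0// => muk.
exists (k.+1%:R^-1)%R, k.+1%:R; split; first by rewrite invr_gt0.
rewrite -/(F k) -(@fineK _ (mu (F k))) ?fin_num_measure//.
by rewrite lee_fin ltW.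
Qed.

End SamplingLaw.

(** * Blocks of the sampling scheme *)

Lemma continuous_matrix {R : realType} (V : topologicalType) (m n : nat)
    (f : V -> 'M[R]_(m, n)) :
  (forall i j, continuous (fun v => f v i j)) -> continuous f.
Proof.
move=> fc v A [B Bf BA].
have : \forall v' \near v, forall ij : 'I_m * 'I_n, B ij.1 ij.2 (f v' ij.1 ij.2).
  by apply: filter_forall => -[i j]; exact: (fc i j v _ (Bf i j)).
by apply: filterS => v' Bv'; apply: BA => i j; exact: (Bv' (i, j)).
Qed.

Lemma compact_rows {R : realType} (m n : nat) (K : 'I_m -> set 'rV[R]_n) :
  (forall i, compact (K i)) ->
  compact [set x : 'M[R]_(m, n) | forall i, K i (row i x)].
Proof.
move=> Kc.
have : @compact (prod_topology (fun=> 'rV[R]_n)) [set g | forall i, K i (g i)].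
  exact: tychonoff.
pose f (g : prod_topology (fun _ : 'I_m => 'rV[R]_n)) : 'M[R]_(m, n) :=
  \matrix_(i, j) g i 0 j.
move=> cK; rewrite (_ : mkset _ = f @` [set g | forall i, K i (g i)]).
  apply: continuous_compact cK; apply: continuous_subspaceT.
  apply: continuous_matrix => i j.
  rewrite (_ : (fun g => f g i j) = fun g => g i ord0 j).
    by apply: continuous_entry; exact: proj_continuous.
  by apply/funext => g; rewrite mxE.
apply/seteqP; split => [x Kx|_ [g Kg <-] i].
  exists (fun i => row i x) => //.
  by apply/matrixP => i j; rewrite !mxE.
suff -> : row i (f g) = g i by exact: Kg.
by apply/rowP => j; rewrite !mxE.
Qed.

Lemma compact_matrix_box {R : realType} (m n : nat) (A : 'I_m -> 'I_n -> set R) :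
  (forall i j, compact (A i j)) ->
  compact [set x : 'M[R]_(m, n) | forall i j, A i j (x i j)].
Proof.
move=> Ac; have := @compact_rows R m n
  (fun i => [set v | forall j, A i j (v ord0 j)]) (fun i => rV_compact (Ac i)).
rewrite (_ : mkset _ = [set x : 'M[R]_(m, n) | forall i j, A i j (x i j)])//.
by apply/seteqP; split => x /= Ax i j; have := Ax i j; rewrite mxE.
Qed.

(** A set open in finitely many coordinates is the countable union of the rational boxes inside it,
    and the preimage of a box is a finite intersection of measurable sets. *)
Lemma measurable_open_parameters {R : realType} (disp : measure_display)
    (Omega : measurableType disp) (P : probability Omega R) (W : Type)
    (J : finType) (e : J -> W) (X : W -> {RV P >-> R}) (G : set (W -> R)) :
  (forall k, exists j, e j = k) ->
  (forall v, G v -> exists2 r : R, 0 < r &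
    forall v', (forall k, `|v' k - v k| < r) -> G v') ->
  measurable [set omega | G (fun k => X k omega)].
Proof.
move=> e_surj Gopen.
pose box (q : {ffun J -> rat} * rat) : set (W -> R) :=
  [set v | forall j, `|v (e j) - ratr (q.1 j)| < ratr q.2].
rewrite (_ : mkset _ = \bigcup_(q in [set: {ffun J -> rat} * rat])
    [set omega | box q `<=` G /\ box q (fun k => X k omega)]); last first.
  apply/seteqP; split => [w /= Gw|w [q _ [qG qw]]]; last exact: qG.
  have [r r0 rG] := Gopen _ Gw.
  (* The box has radius r' around a point within r' of the sample, so it stays within 2 r' < r of
     the sample. *)
  have /(@rat_in_itvoo R)[r' ] : 0 < r / 2 by rewrite divr_gt0.
  rewrite in_itv/= => /andP[r'0 r'r].
  have /choice[q qP] : forall j : J, exists q : rat, `|X (e j) w - ratr q| < ratr r'.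
    move=> j; have /(@rat_in_itvoo R)[q] : X (e j) w - ratr r' < X (e j) w + ratr r'.
      by lra.
    by rewrite in_itv/= => /andP[q1 q2]; exists q; rewrite ltr_norml; lra.
  exists ([ffun j => q j], r') => //; split => /=.
    move=> v vq; apply: rG => k; have [j <-] := e_surj k.
    have := vq j; have := qP j; rewrite /= ffunE !ltr_norml; lra.
  by move=> j; rewrite /= ffunE.
apply: countable_bigcupT_measurable => // q.
have [qG|qG] := pselect (box q `<=` G); last first.
  by rewrite (_ : mkset _ = set0)//; apply/seteqP; split => w // [].
rewrite (_ : mkset _ = \bigcap_(j in [set: J])
    X (e j) @^-1` ball (ratr (q.1 j) : R) (ratr q.2)).
  apply: fin_bigcap_measurable => // j _.
  rewrite -[X in measurable X]setTI; apply: measurable_funP => //.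
  exact: measurable_ball.
apply/seteqP; split => w /=.
  by move=> [_ qw] j _; rewrite /ball/= distrC; exact: qw.
by move=> qw; split => // j; have := qw j Logic.I; rewrite /ball/= distrC.
Qed.

Section SchemeIncrement.
Context {R : realType} (d T' M : nat) (Mi : 'I_d -> nat) (sigma : R -> R).
Hypothesis sigma0 : sigma 0 = 0.

Local Notation windex := (windex T' M Mi).

Definition scheme_theta (v : windex -> R) : 'M[R]_(T' * d) * 'rV[R]_d :=
  (upperU v, \row_i v (Walpha T' M Mi i)).

(** Coordinate 0 addresses the bias and the others a row of the matrix, as in [neuron]. *)
Definition neuron_index (k : 'I_M) (i : 'I_(T'.+1 * d).+1) : windex :=
  if unlift ord0 i is Some m then WA1 Mi k m else Wxi1 T' Mi k.

Definition neuron_index2 (i : 'I_d) (k : 'I_(Mi i)) (l : 'I_(T'.+1 * d).+1) :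
    windex :=
  if unlift ord0 l is Some m then WA2 M k m else Wxi2 T' M k.

Lemma hidden_ext n (A : 'M[R]_n) (b b' : nat -> 'cV[R]_n) t :
  (forall s, (s < t)%N -> b s = b' s) -> hidden sigma A b t = hidden sigma A b' t.
Proof.
elim: t => //= t IH bb; rewrite bb// IH// => s st.
by apply: bb; rewrite ltnS ltnW.
Qed.

Lemma map_mx0 m n : map_mx sigma (0 : 'M[R]_(m, n)) = 0.
Proof. by apply/matrixP => i j; rewrite !mxE sigma0. Qed.

(** All nonzero columns of A_1 belong to the last block, so only [dsubmx h] survives; likewise for
    A_2^i. *)
Lemma schemeA1_affine (v : windex -> R)
    (h : 'cV[R]_(M + \sum_(i < d) Mi i + T'.+1 * d)) :
  schemeA1 v *m h + schemexi1 v =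
  col_mx (col_mx (\matrix_(j, k) v (WA1 Mi j k) *m dsubmx h +
                  \col_j v (Wxi1 T' Mi j)) 0)
         (schemeA12 v *m dsubmx h).
Proof.
rewrite /schemeA1 /schemexi1 -[X in _ *m X]vsubmxK mul_block_col !mul0mx !add0r.
by rewrite mul_col_mx mul0mx !add_col_mx !addr0.
Qed.

Lemma schemeA2_affine (v : windex -> R) (i : 'I_d)
    (h : 'cV[R]_(M + \sum_(i < d) Mi i + T'.+1 * d)) :
  schemeA2 v i *m h + schemexi2 v i =
  col_mx (col_mx 0 (\mxcol_j (if j == i then
                      \matrix_(k, l) v (WA2 M k l) *m dsubmx h +
                      \col_k v (Wxi2 T' M k) else 0)))
         (v (Walpha T' M Mi i) *: delta_mx (lshift (T' * d) i) 0).
Proof.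
rewrite /schemeA2 /schemexi2 -[X in _ *m X]vsubmxK mul_block_col !mul0mx !add0r.
rewrite mul_col_mx mul0mx !add_col_mx !add0r mxcol_mul -mxcolD.
congr (col_mx (col_mx _ _) _); apply: eq_mxcol => j.
by case: eqP => // _; rewrite mul0mx addr0.
Qed.

Lemma scheme_RS_last_block (v : windex -> R) (x : 'M[R]_(T'.+1, d)) t :
  dsubmx (RS sigma (schemeA1 v) (schemexi1 v) (schemeA2 v) (schemexi2 v) x t
    : 'cV[R]_(M + \sum_(i < d) Mi i + T'.+1 * d)) =
  hidden sigma (schemeA12 v)
    (drive T' sigma (fun i => v (Walpha T' M Mi i)) (fun s => x (inord s))) t.
Proof.
elim: t => [|t IH] /=; first by rewrite linear0.
rewrite !linearD/= linear_sum/= IH; congr (_ + _ + _).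
  by rewrite schemeA1_affine map_col_mx col_mxKd IH.
transitivity (\sum_(i < d) x (inord t) i *:
    map_mx sigma (v (Walpha T' M Mi i) *:
      (delta_mx (lshift (T' * d) i) 0 : 'cV[R]_(d + T' * d)))).
  by apply: eq_bigr => i _; rewrite linearZ/= schemeA2_affine map_col_mx col_mxKd.
apply/colP => k; rewrite summxE /drive; case: (@split_ordP d (T' * d) k) => j ->.
  rewrite col_mxEu mxE (bigD1 j)//= big1 => [|i ij]; rewrite !mxE.
    by rewrite !eqxx mulr1 addr0 mulrC.
  by rewrite (inj_eq (@lshift_inj _ _)) eq_sym (negbTE ij) mulr0 sigma0 mulr0.
rewrite col_mxEd mxE big1 // => i _; rewrite !mxE.
by rewrite eq_rlshift mulr0 sigma0 mulr0.
Qed.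

(** The state at time T - 1 has not seen x_T, and the earlier observations are the rows kept by
    [row' ord_max]. *)
Lemma scheme_RS_last_blockE (v : windex -> R) (x : 'M[R]_(T'.+1, d)) :
  dsubmx (RS sigma (schemeA1 v) (schemexi1 v) (schemeA2 v) (schemexi2 v) x T'
    : 'cV[R]_(M + \sum_(i < d) Mi i + T'.+1 * d)) =
  last_block sigma (scheme_theta v) (row' ord_max x).
Proof.
rewrite scheme_RS_last_block; apply: hidden_ext => s sT.
rewrite /drive; congr col_mx; apply/colP => i; rewrite !mxE /stream insubT mxE.
suff -> : inord s = lift ord_max (Sub s sT) by [].
by apply: val_inj; rewrite [RHS]lift_max /= inordK// ltnW.
Qed.

(** Since [sigma 0 = 0] annihilates zero blocks, block 1 of the increment receives only the A_1 term
    and block i+1 only the A_2^i term; the last block is masked by the zeros of the output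
    vector. *)
Lemma dotprod_scheme_DeltaRS (v : windex -> R) (x : 'M[R]_(T'.+1, d))
    (w : 'cV[R]_M) (wi : forall i : 'I_d, 'cV[R]_(Mi i)) :
  dotprod (output_vector T' w wi) (scheme_DeltaRS v sigma x) =
  \sum_(k < M) w k 0 *
    cell sigma (v \o neuron_index k) (scheme_theta v) (row' ord_max x) +
  \sum_(i < d) (\sum_(k < Mi i) wi i k 0 *
    cell sigma (v \o neuron_index2 k) (scheme_theta v) (row' ord_max x)) *
    x ord_max i.
Proof.
have -> (a b : 'cV[R]_(sigdim T' M Mi)) : dotprod a b = (a^T *m b) 0 0.
  by rewrite mxE; apply: eq_bigr => k _; rewrite mxE.
rewrite /scheme_DeltaRS /DeltaRS /= /output_vector.
set h := RS _ _ _ _ _ _ _.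
rewrite -[h + _ + _]addrA [h + _]addrC addrK.
have hE := scheme_RS_last_blockE v x; rewrite -/h in hE.
have cellE (q : 'I_(T'.+1 * d).+1 -> R) n (A : 'M[R]_(n, T'.+1 * d)) (b : 'cV_n) k :
    (forall i, q i = if unlift ord0 i is Some m then A k m else b k 0) ->
    map_mx sigma (A *m dsubmx (h : 'cV[R]_(M + \sum_(i < d) Mi i + T'.+1 * d)) + b) k 0
    = cell sigma q (scheme_theta v) (row' ord_max x).
  move=> qE; rewrite hE !mxE /cell /neuron qE unlift_none; congr (sigma (_ + _)).
  by apply: eq_bigr => m _; rewrite qE liftK.
rewrite !tr_col_mx trmx0 mulmxDr mxE; congr (_ + _).
  rewrite schemeA1_affine !map_col_mx !mul_row_col map_mx0 mulmx0 mul0mx !addr0.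
  rewrite mxE; apply: eq_bigr => k _; rewrite mxE; congr (_ * _).
  apply: cellE => i; rewrite /= /neuron_index.
  by case: (unlift ord0 i) => [m|]; rewrite !mxE.
have -> : inord T' = ord_max :> 'I_T'.+1 by apply: val_inj; rewrite /= inordK.
rewrite mulmx_sumr summxE; apply: eq_bigr => i _.
rewrite -scalemxAr mxE mulrC; congr (_ * _).
rewrite schemeA2_affine !map_col_mx !mul_row_col map_mx0 mulmx0 mul0mx addr0 add0r.
rewrite tr_mxcol.
have -> : map_mx sigma (\mxcol_j (if j == i then
      \matrix_(k, l) v (WA2 M k l) *m dsubmx (h : 'cV[R]_(M + \sum_(i < d) Mi i + T'.+1 * d)) +
      \col_k v (Wxi2 T' M k) else 0) : 'cV[R]_(\sum_(i < d) Mi i)) =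
   \mxcol_j (if j == i then map_mx sigma (
      \matrix_(k, l) v (WA2 M k l) *m dsubmx (h : 'cV[R]_(M + \sum_(i < d) Mi i + T'.+1 * d)) +
      \col_k v (Wxi2 T' M k)) else 0).
  apply/matrixP => k l; rewrite !mxE; case: ifP => _; rewrite ?mxE//.
rewrite mul_mxrow_mxcol (bigD1 i)//= eqxx [X in _ + X]big1 ?addr0 => [|j /negbTE->].
  rewrite mxE; apply: eq_bigr => k _; rewrite mxE; congr (_ * _).
  apply: cellE => l; rewrite /= /neuron_index2.
  by case: (unlift ord0 l) => [m|]; rewrite !mxE.
by rewrite mulmx0.
Qed.

End SchemeIncrement.

(** * Measurability of the approximation event *)

Section Measurability.
Context {R : realType} (d T' M : nat) (Mi : 'I_d -> nat).
Local Notation windex := (windex T' M Mi).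

Lemma windex_finite : exists (J : finType) (e : J -> windex),
  forall k, exists j, e j = k.
Proof.
pose J : finType := (('I_M * 'I_(T'.+1 * d)) +
  {p : 'I_(T' * d) * 'I_(T' * d) | (p.1 <= p.2)%N} + 'I_M +
  {i : 'I_d & 'I_(Mi i) * 'I_(T'.+1 * d)}%type + {i : 'I_d & 'I_(Mi i)} + 'I_d)%type.
pose e (j : J) : windex :=
  match j with
  | inl (inl (inl (inl (inl (k, m))))) => WA1 Mi k m
  | inl (inl (inl (inl (inr p)))) => WU M Mi p
  | inl (inl (inl (inr k))) => Wxi1 T' Mi k
  | inl (inl (inr (existT _ (k, m)))) => WA2 M k m
  | inl (inr (existT _ k)) => Wxi2 T' M k
  | inr i => Walpha T' M Mi i
  end.
exists J, e; case=> [k m|p|k|i k m|i k|i].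
- by exists (inl (inl (inl (inl (inl (k, m)))))).
- by exists (inl (inl (inl (inl (inr p))))).
- by exists (inl (inl (inl (inr k)))).
- by exists (inl (inl (inr (existT _ i (k, m))))).
- by exists (inl (inr (existT _ i k))).
- by exists (inr i).
Qed.

Variables (sigma : R -> R) (f : 'M[R]_(T'.+1, d) -> R).
Hypotheses (sigma0 : sigma 0 = 0) (sigma_cont : continuous sigma).

Lemma continuous_scheme_output (V : topologicalType) (v : V -> windex -> R)
    (x : V -> 'M[R]_(T'.+1, d)) (w : 'cV[R]_M) (wi : forall i, 'cV[R]_(Mi i)) :
  (forall k, continuous (fun a => v a k)) -> continuous x ->
  continuous (fun a =>
    dotprod (output_vector T' w wi) (scheme_DeltaRS (v a) sigma (x a))).
Proof.
move=> vc xc; under eq_fun do rewrite dotprod_scheme_DeltaRS//.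
have thc : continuous (fun a => scheme_theta (v a)).
  have Uc : continuous (fun a => upperU (v a)).
    apply: continuous_matrix => i j; rewrite /upperU.
    under eq_fun do rewrite mxE.
    by case: insub => [p|]; [exact: vc|move=> a; exact: cvg_cst].
  have ac : continuous (fun a => \row_i v a (Walpha T' M Mi i)).
    by apply: continuous_matrix => i j; under eq_fun do rewrite mxE; exact: vc.
  by move=> a; exact: (cvg_pair (Uc a) (ac a)).
have yc : continuous (fun a => row' ord_max (x a)).
  apply: continuous_matrix => i j; under eq_fun do rewrite mxE.
  exact: continuous_entry.
have cellc (idx : 'I_(T'.+1 * d).+1 -> windex) : continuous (fun a =>
    cell sigma (v a \o idx) (scheme_theta (v a)) (row' ord_max (x a))).
  rewrite (_ : (fun a => _) = fun a => cell sigma ((\row_i v a (idx i)) ord0)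
      (scheme_theta (v a)) (row' ord_max (x a))).
    apply: continuous_cell => //; apply: continuous_matrix => i j.
    by under eq_fun do rewrite mxE; exact: vc.
  apply/funext => a; congr (cell sigma _ _ _); apply/funext => i.
  by rewrite mxE.
move=> a; apply: cvgD.
  move: a; apply: continuous_sum => k a; apply: cvgM; first exact: cvg_cst.
  exact: cellc.
move: a; apply: continuous_sum => i a; apply: cvgM; last exact: continuous_entry.
move: a; apply: continuous_sum => k a; apply: cvgM; first exact: cvg_cst.
exact: cellc.
Qed.

(** With the output weights held fixed, a supremum below eps survives small changes of the sampled
    weights, by compactness of [S]; the event is thus open in the parameters. *)
Lemma measurable_approximation_event (S : set 'M[R]_(T'.+1, d)) (eps : R)
    (disp : measure_display) (Omega : measurableType disp)
    (P : probability Omega R) (X : windex -> {RV P >-> R}) :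
  compact S ->
  measurable [set omega | exists (w : 'cV[R]_M) (wi : forall i, 'cV[R]_(Mi i)),
    (ereal_sup [set `|f x - dotprod (output_vector T' w wi)
                 (scheme_DeltaRS (fun k => X k omega) sigma x)|%:E
               | x in S] < eps%:E)%E].
Proof.
move=> Sc; have [J [e e_surj]] := windex_finite.
apply: (@measurable_open_parameters _ _ _ _ _ _ e X [set v |
  exists (w : 'cV[R]_M) (wi : forall i, 'cV[R]_(Mi i)),
    (ereal_sup [set `|f x - dotprod (output_vector T' w wi)
                 (scheme_DeltaRS v sigma x)|%:E | x in S] < eps%:E)%E]) => //.
move=> v [w [wi supv]].
have [s seps sup_s] : exists2 s, s < eps & forall x, S x ->
    `|f x - dotprod (output_vector T' w wi) (scheme_DeltaRS v sigma x)| <= s.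
  move: supv; set A := [set _ | _ in _] => supv.
  have [s seps As] : exists2 s, s < eps & (ereal_sup A <= s%:E)%E.
    move: supv; case: (ereal_sup A) => [s| |] //=; first by rewrite lte_fin; exists s.
    (* The supremum is -oo when [S] is empty. *)
    by move=> _; exists (eps - 1); rewrite ?leNye// ltrBlDr ltrDl.
  exists s => // x Sx; rewrite -lee_fin; apply: le_trans As.
  by apply: ereal_sup_ubound; exists x.
have [r rP] := choice e_surj.
(* Row vectors give the parameters a topology; [r] is a section of [e], so [par] recovers every
   weight. *)
pose n := #|J|; pose par (u : 'rV[R]_n) (k : windex) : R := u ord0 (enum_rank (r k)).
pose u0 : 'rV[R]_n := \row_j v (e (enum_val j)).
have paru0 (v' : windex -> R) : par (\row_j v' (e (enum_val j))) = v'.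
  by apply/funext => k; rewrite /par mxE enum_rankK rP.
have d0 : 0 < (eps - s) / 2 by rewrite divr_gt0 ?subr_gt0.
have := @near_compact_continuous R 'rV[R]_n 'M[R]_(T'.+1, d) S
  (fun p => dotprod (output_vector T' w wi) (scheme_DeltaRS (par p.1) sigma p.2))
  u0 Sc.
case/(_ _ _ d0)/nbhs_ballP.
  apply: continuous_scheme_output; last by move=> p; exact: cvg_snd.
  by move=> k; apply: continuous_entry => p; exact: cvg_fst.
move=> rad /= rad0 radP; exists rad => // v' v'v.
exists w, wi; apply: (@le_lt_trans _ _ ((s + (eps - s) / 2)%:E)); last first.
  rewrite lte_fin; lra.
apply: ub_ereal_sup => _ [x Sx <-]; rewrite lee_fin.
have /radP/(_ x Sx) : ball u0 rad (\row_j v' (e (enum_val j))).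
  by split => // i j; rewrite !mxE /ball/= distrC.
rewrite /= !paru0; have := sup_s _ Sx.
set a := dotprod _ _; set b := dotprod _ _ => h1 h2.
have -> : f x - b = (f x - a) + - (b - a) by ring.
by rewrite (le_trans (ler_normD _ _))// normrN lerD// ltW.
Qed.

End Measurability.

(** * Probability that a box of weights is hit *)

Section HittingProbability.
Context {R : realType}.

Lemma all_expr_small (T : eqType) (L : seq T) (p : T -> R) (r : R) : 0 < r ->
  (forall t, t \in L -> 0 < p t <= 1) ->
  exists M, (0 < M)%N /\ forall t, t \in L -> (1 - p t) ^+ M <= r.
Proof.
move=> r0 p01.
have [M0 _ M0P] : \forall M \near \oo, forall t, t \in L -> (1 - p t) ^+ M <= r.
  elim: L p01 => [_|t L IH p01]; first exact: nearW.
  have /andP[pt0 pt1] := p01 _ (mem_head _ _).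
  have /cvgrPdist_le/(_ _ r0) : (GRing.exp (1 - p t) : R^nat) @ \oo --> 0.
    by apply: cvg_expr; rewrite ger0_norm ?subr_ge0// ltrBlDr ltrDl.
  apply: filterS2 (IH _) => [M MP Mt t'|t' t'L]; last first.
    by apply: p01; rewrite inE t'L orbT.
  rewrite inE => /predU1P[->|/MP//]; apply: le_trans Mt.
  by rewrite sub0r normrN ler_norm.
by exists M0.+1; split => // t tL; apply: M0P => //=.
Qed.

Variables (d T' M : nat) (Mi : 'I_d -> nat).
Context (disp : measure_display) (Omega : measurableType disp).
Variables (P : probability Omega R) (mu : probability (measurableTypeR R) R).
Variable X : windex T' M Mi -> {RV P >-> R}.
Hypothesis X_iid : iid X mu.

(** On neuron weights it returns the neuron and the coordinate as numbers, so injectivity of the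
    indexings needs no inversion of dependent constructors. *)
Let node (w : windex T' M Mi) : nat * nat :=
  match w with
  | WA1 k m => (nat_of_ord k, m.+1)
  | Wxi1 k => (nat_of_ord k, 0%N)
  | WA2 i k m => (nat_of_ord k, m.+1)
  | Wxi2 i k => (nat_of_ord k, 0%N)
  | _ => (0, 0)%N
  end.

Lemma neuron_index_inj (k l : 'I_M) (i j : 'I_(T'.+1 * d).+1) :
  neuron_index Mi k i = neuron_index Mi l j -> k = l /\ i = j.
Proof.
have E k' (i' : 'I_(T'.+1 * d).+1) :
      node (neuron_index Mi k' i') = (nat_of_ord k', nat_of_ord i').
  by rewrite /neuron_index; case: unliftP => [m|] ->.
by move=> /(congr1 node); rewrite !E => -[/val_inj -> /val_inj ->].
Qed.

Lemma neuron_index2_inj o (k l : 'I_(Mi o))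
    (i j : 'I_(T'.+1 * d).+1) :
  neuron_index2 M k i = neuron_index2 M l j -> k = l /\ i = j.
Proof.
have E (k' : 'I_(Mi o)) (i' : 'I_(T'.+1 * d).+1) :
      node (neuron_index2 M k' i') = (nat_of_ord k' : nat, nat_of_ord i').
  by rewrite /neuron_index2; case: unliftP => [m|] ->.
by move=> /(congr1 node); rewrite !E => -[/val_inj -> /val_inj ->].
Qed.

Definition target_probability (t : 'rV[R]_(T'.+1 * d).+1 * R) : R :=
  \prod_i fine (mu (ball (t.1 ord0 i) t.2)).

Lemma target_probability01 t : full_support mu -> 0 < t.2 ->
  0 < target_probability t <= 1.
Proof.
move=> mu_supp t0; apply/andP; split; last first.
  have mB i : measurable (ball (t.1 ord0 i) t.2 : set (measurableTypeR R)).
    exact: measurable_ball.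
  apply: prodr_ile1 => i _; rewrite fine_ge0//= -lee_fin fineK ?fin_num_measure//.
  exact: probability_le1.
apply: prodr_gt0 => i _; apply: fine_gt0; apply/andP; split; last first.
  by rewrite (le_lt_trans (probability_le1 _ _)) ?ltry//; exact: measurable_ball.
have : measure_support mu (t.1 ord0 i) by rewrite mu_supp.
apply; first exact: ball_open.
exact: ballxx.
Qed.

Lemma hits_probability (N : nat)
    (idx : 'I_N -> 'I_(T'.+1 * d).+1 -> windex T' M Mi) t :
  (forall k l i j, idx k i = idx l j -> k = l /\ i = j) ->
  let H := [set omega | hits (fun k i => X (idx k i) omega) t] in
  measurable H /\ P (~` H) = ((1 - target_probability t) ^+ N)%:E.
Proof.
move=> idx_inj H.
pose B i : set R := ball (t.1 ord0 i) t.2.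
have mB i : measurable (B i) by exact: measurable_ball.
have HC : ~` H = [set omega | forall k, ~ forall i, B i (X (idx k i) omega)].
  apply/seteqP; split => w /=.
    by move=> nh k h; apply: nh; exists k => i; rewrite distrC; exact: h.
  by move=> nh [k h]; apply: (nh k) => i; rewrite /B/ball/= distrC; exact: h.
have mC : measurable (~` H).
  rewrite HC (_ : mkset _ = \bigcap_(k in [set: 'I_N])
      ~` \bigcap_(i in [set: 'I_(T'.+1 * d).+1]) X (idx k i) @^-1` B i).
    apply: fin_bigcap_measurable => // k _; apply: measurableC.
    apply: fin_bigcap_measurable => // i _.
    by rewrite -[X in measurable X]setTI; apply: measurable_funP.
  apply/seteqP; split => w /=.
    by move=> h k _ h'; apply: (h k) => i; exact: h'.
  by move=> h k h'; apply: (h k Logic.I) => i _; exact: h'.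
split; first by rewrite -[H]setCK; exact: measurableC.
rewrite HC (@miss_probability _ _ _ _ _ X _ _ idx B (target_probability t))//.
  exact: X_iid.1.
move=> k; rewrite -prodEFin; apply: eq_bigr => i _.
have := X_iid.2 (idx k i) _ (mB i); rewrite /distribution/pushforward/= => ->.
by rewrite fineK//; apply: fin_num_measure; exact: (mB i).
Qed.

End HittingProbability.

(** * Choice of constants and combination of the two random events *)

Theorem proposition12 (R : realType) (T' d : nat) (hd : (0 < d)%N)
  (K : set 'rV[R]_d) (hK : compact K)
  (f : 'M[R]_(T'.+1, d) -> R)
  (hf : {within stream_set (T := T'.+1) K, continuous f})
  (g : 'M[R]_(T', d) -> R) (h : 'I_d -> 'M[R]_(T', d) -> R)
  (hg : continuous g) (hh : forall i, continuous (h i))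
  (hfgh : forall x, stream_set K x ->
     f x = g (row' ord_max x) +
           \sum_(i < d) h i (row' ord_max x) * x ord_max i)
  (sigma : R -> R)
  (sigma_cont : continuous sigma)
  (sigma_bnd : exists C : R, forall y, `|sigma y| <= C)
  (sigma_nonpoly : ~ exists p : {poly R}, forall y, sigma y = p.[y])
  (sigma_inj : injective sigma)
  (sigma0 : sigma 0 = 0)
  (mu2 : probability (measurableTypeR R) R)
  (mu2_ac : mu2 `<< (@lebesgue_measure R))
  (mu2_supp : full_support mu2)
  (alpha : R) (halpha : 0 < alpha < 1) (eps : R) (heps : 0 < eps) :
  exists (M : nat) (Mi : 'I_d -> nat),
    [/\ (0 < M)%N, (forall i, (0 < Mi i)%N) &
    forall (disp : measure_display) (Omega : measurableType disp)
      (P : probability Omega R)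
      (X : windex T' M Mi -> {RV P >-> R}),
      iid X mu2 ->
      let E : set Omega :=
        [set omega | exists (w : 'cV[R]_M) (wi : forall i, 'cV[R]_(Mi i)),
          (ereal_sup [set `|f x - dotprod (output_vector T' w wi)
                       (scheme_DeltaRS (fun k => X k omega) sigma x)|%:E
                     | x in stream_set (T := T'.+1) K] < eps%:E)%E] in
      measurable E /\ (alpha%:E < P E)%E].
Proof.
pose Y : set 'M[R]_(T', d) := stream_set K.
have Yc : compact Y by exact: (compact_rows (fun=> hK)).
have KTc : compact (stream_set (T := T'.+1) K) by exact: (compact_rows (fun=> hK)).
have /choice[BK BKP] : forall i : 'I_d, exists b : R,
    forall r, K r -> `|r ord0 i| <= b.
  move=> i.
  apply: (@compact_continuous_bounded R _ K (fun r => r ord0 i)) => //.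
  exact: coord_continuous.
(* The error of g counts once and that of h_i is multiplied by |x_T^i| <= |BK i|, so errors e add up
   to at most e * B = eps / 2, strictly below eps even after the supremum. *)
pose B := 1 + \sum_i `|BK i|.
have B0 : 0 < B by rewrite ltr_pwDl// sumr_ge0.
pose e := eps / 2 / B; have e0 : 0 < e by rewrite !divr_gt0.
pose J : finType := ({p : 'I_(T' * d) * 'I_(T' * d) | (p.1 <= p.2)%N} + 'I_d)%type.
(* The two bad events, (U, alpha) outside the compact set and some box missed, get at most (1 -
   alpha)/4 each. The total (1 - alpha)/2 is strictly below 1 - alpha. *)
pose a4 := (1 - alpha) / 4.
have a40 : 0 < a4 by rewrite divr_gt0// subr_gt0; case/andP: halpha.
pose r1 := a4 / #|{: J}|.+1%:R; have r10 : 0 < r1 by rewrite divr_gt0.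
have [c [C [c0 cC]]] := annulus_probability mu2_ac r10.
pose A : set R := [set y | c <= `|y| <= C].
have A_neq0 y : A y -> y != 0.
  by move=> /andP[cy _]; rewrite -normr_gt0; exact: lt_le_trans cy.
(* The upper bounds of the annulus give compactness; its lower bounds on the diagonal of U and on
   alpha give nondegeneracy. *)
pose Th : set ('M[R]_(T' * d) * 'rV[R]_d) :=
  [set U : 'M[R]_(T' * d) | forall j l : 'I_(T' * d),
    (if (j <= l)%N then A else [set 0]) (U j l)]
  `*` [set al : 'rV[R]_d | forall i, A (al ord0 i)].
have Thc : compact Th.
  apply: compact_setX; last first.
    by apply: (@rV_compact R d (fun=> A)) => i; exact: compact_annulus.
  apply: (@compact_matrix_box R _ _
    (fun j l => if (j <= l)%N then A else [set 0])) => j l; case: ifP => _; first exact: compact_annulus.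
  exact: compact_set1.
have Thn th : Th th -> nondegenerate th.
  move=> [U0 al0]; split => [j l lj|j|i]; last exact/A_neq0/al0.
    by have := U0 j l; rewrite leqNgt lj.
  by have := U0 j j; rewrite leqnn => /A_neq0.
pose targets (F : 'M[R]_(T', d) -> R) (L : seq ('rV[R]_(T'.+1 * d).+1 * R)) :=
    (forall t, t \in L -> 0 < t.2) /\
    forall th, Th th -> forall M (p : 'I_M -> 'I_(T'.+1 * d).+1 -> R),
      (forall t, t \in L -> hits p t) ->
      exists w : 'I_M -> R, forall y, Y y ->
        `|F y - \sum_(k < M) w k * cell sigma (p k) th y| <= e.
have ex_targets F : continuous F -> exists L, targets F L.
  move=> Fc; exact: (uniform_targets hd sigma_inj sigma0 sigma_cont Yc sigma_bnd
    Thc Thn Fc e0).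
have [Lg [Lg0 LgP]] := ex_targets g hg.
have [Lh LhP] := choice (fun i => ex_targets (h i) (hh i)).
pose L := Lg ++ flatten [seq Lh i | i <- enum 'I_d].
have LhL i t : t \in Lh i -> t \in L.
  move=> tL; rewrite mem_cat; apply/orP; right; apply/flatten_mapP.
  by exists i => //; rewrite mem_enum.
have L0 t : t \in L -> 0 < t.2.
  rewrite mem_cat => /orP[/Lg0//|/flatten_mapP[i _]].
  by have [Lh0 _] := LhP i; exact: Lh0.
(* Each box must be hit in each of the d + 1 neuron families: [None] stands for block 1 and [Some i]
   for the block of h_i. *)
pose O : seq (option 'I_d * ('rV[R]_(T'.+1 * d).+1 * R)) :=
  [seq (b, t) | b <- enum {: option 'I_d}, t <- L].
pose r2 := a4 / (size O).+1%:R; have r20 : 0 < r2 by rewrite divr_gt0.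
have [M [M0 MP]] := all_expr_small r20
  (fun t tL => target_probability01 mu2_supp (L0 t tL)).
exists M, (fun=> M); split => // disp Omega P X X_iid E.
have mE : measurable E by exact: measurable_approximation_event.
split => //.
pose coord (j : J) : windex T' M (fun=> M) :=
  match j with inl p => WU M _ p | inr i => Walpha T' M _ i end.
pose H1 (j : J) : set Omega := X (coord j) @^-1` A.
pose idx (b : option 'I_d) : 'I_M -> 'I_(T'.+1 * d).+1 -> windex T' M (fun=> M) :=
  if b is Some i then @neuron_index2 d T' M (fun=> M) i
  else @neuron_index d T' M (fun=> M).
have idx_inj b k l i j : idx b k i = idx b l j -> k = l /\ i = j.
  by case: b => [b|]; [exact: neuron_index2_inj|exact: neuron_index_inj].
pose H2 (ot : option 'I_d * ('rV[R]_(T'.+1 * d).+1 * R)) : set Omega :=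
  [set omega | hits (fun k i => X (idx ot.1 k i) omega) ot.2].
have mA : measurable (A : set (measurableTypeR R)) by exact: measurable_annulus.
have [m1 P1] : measurable (\big[setI/setT]_(j <- enum {: J}) H1 j) /\
    (P (~` \big[setI/setT]_(j <- enum {: J}) H1 j) <=
      ((size (enum {: J}))%:R * r1)%:E)%E.
  apply: union_bound => j _; split.
    by rewrite -[X in measurable X]setTI; exact: measurable_funP.
  have := X_iid.2 (coord j) _ (measurableC mA).
  by rewrite /distribution/pushforward/= => ->.
have [m2 P2] : measurable (\big[setI/setT]_(ot <- O) H2 ot) /\
    (P (~` \big[setI/setT]_(ot <- O) H2 ot) <= ((size O)%:R * r2)%:E)%E.
  apply: union_bound => -[b t] /allpairsP[[b' t'] /= [_ tL [-> ->]]].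
  have [mH PH] := hits_probability X_iid t' (idx_inj b').
  by split => //; rewrite PH lee_fin; exact: MP.
set HH1 := \big[setI/setT]_(j <- _) _ in m1 P1.
set HH2 := \big[setI/setT]_(j <- O) _ in m2 P2.
have PHH : (alpha%:E < P (HH1 `&` HH2))%E.
  have mH : measurable (HH1 `&` HH2) by exact: measurableI.
  have small (n : nat) : n%:R * (a4 / n.+1%:R) <= a4.
    rewrite mulrCA; apply: ler_piMr; first exact: ltW.
    by rewrite ler_pdivrMr// mul1r ler_nat.
  have PC : (P (~` (HH1 `&` HH2)) <= (a4 + a4)%:E)%E.
    rewrite setCI (le_trans (measureU2 _ _ _))//; [exact: measurableC|exact: measurableC|].
    rewrite EFinD leeD//.
      by apply: le_trans P1 _; rewrite lee_fin -cardE; exact: small.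
    by apply: le_trans P2 _; rewrite lee_fin; exact: small.
  have := probability_setC P (measurableC mH); rewrite setCK => ->.
  move: PC.
  rewrite -(@fineK _ (P (~` (HH1 `&` HH2)))) ?fin_num_measure//; last exact: measurableC.
  rewrite lee_fin -EFinB lte_fin => PC; case/andP: halpha => _ al1.
  by rewrite /a4 in PC; lra.
apply: lt_le_trans PHH _; apply: le_measure; rewrite ?inE//; first exact: measurableI.
(* The rest is deterministic: at a fixed outcome in both good events, the targets provide the output
   weights. *)
move=> w [H1w H2w].
pose v k := X k w.
have vA (j : J) : A (v (coord j)).
  by move: H1w; rewrite /HH1 -bigcap_seq => /(_ j); apply; rewrite /= mem_enum.
have vhit b t : t \in L -> hits (fun k i => v (idx b k i)) t.
  move=> tL; move: H2w; rewrite /HH2 -bigcap_seq => /(_ (b, t)); apply => /=.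
  by apply/allpairsP; exists (b, t); split; rewrite //= mem_enum.
have thv : Th (scheme_theta v).
  split => /=; last by move=> i; rewrite mxE; exact: (vA (inr i)).
  move=> j l; rewrite mxE; case: ifP => jl; last by rewrite insubF.
  by rewrite insubT; exact: (vA (inl _)).
have [w0 w0P] : exists w0 : 'I_M -> R, forall y, Y y ->
    `|g y - \sum_(k < M) w0 k * cell sigma (v \o neuron_index _ k) (scheme_theta v) y| <= e.
  apply: (LgP _ thv M (fun k i => v (idx None k i))) => t tL; apply: vhit.
  by rewrite mem_cat tL.
have /choice[wi wiP] : forall i, exists wi : 'I_M -> R, forall y, Y y ->
    `|h i y - \sum_(k < M) wi k *
       cell sigma (v \o @neuron_index2 d T' M (fun=> M) i k) (scheme_theta v) y| <= e.
  move=> i; apply: ((LhP i).2 _ thv M (fun k j => v (idx (Some i) k j))) => t tL.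
  by apply: vhit; exact: LhL tL.
exists (\col_k w0 k), (fun i => \col_k wi i k).
apply: (@le_lt_trans _ _ (eps / 2)%:E); last by rewrite lte_fin; lra.
apply: ub_ereal_sup => _ [x Kx <-]; rewrite lee_fin hfgh// dotprod_scheme_DeltaRS//.
set y := row' ord_max x.
have Yy : Y y.
  move=> t; have := Kx (lift ord_max t); congr K.
  by apply/rowP => j; rewrite !mxE.
rewrite opprD addrACA -sumrB.
have -> : eps / 2 = e + \sum_(i < d) e * `|BK i|.
  by rewrite -mulr_sumr -[X in X + _]mulr1 -mulrDr -/B divfK// gt_eqF.
apply: le_trans (ler_normD _ _) _; apply: lerD.
  have := w0P _ Yy; congr (`|_ - _| <= _).
  by apply: eq_bigr => k _; rewrite mxE.
apply: le_trans (ler_norm_sum _ _ _) _; apply: ler_sum => i _.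
rewrite -mulrBl normrM; apply: ler_pM => //.
  have := wiP i _ Yy; congr (`|_ - _| <= _).
  by apply: eq_bigr => k _; rewrite mxE.
apply: le_trans (ler_norm _); have := BKP i _ (Kx ord_max).
by rewrite mxE.
Qed.
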